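(* Let $P$ be a probability measure on $\mathbb{R}^p$ that is absolutely continuous with respect to the Lebesgue measure, with density $f$. Let $\tau>0$. Suppose that $f$ is $\tau$-centrally symmetric about a mode (resp. an antimode) $m$ of $f$ and has continuous second order partial derivatives in $\overline{B}_\tau(m)=\{x\in\mathbb{R}^p:\|x-m\|\le\tau\}$. If, for all $x_1,x_2\in\overline{B}_\tau(m)$, the matrix $$G_f(x_1,x_2)=H_f(x_1)f(x_2)+\nabla f(x_1)\nabla f(x_2)^{\top}$$ is negative (resp. positive) definite, then $m$ is also a mode (resp. an antimode) for $f_\tau$.
   Context: $p\ge 1$; $\|\cdot\|$ is the Euclidean norm on $\mathbb{R}^p$. For $x\in\mathbb{R}^p$ and $\tau\in[0,\infty]$, $$Z_\tau(x)=\{(x_1,x_2)\in\mathbb{R}^p\times\mathbb{R}^p:\ \max_{i=1,2}\|x-x_i\|\le\|x_1-x_2\|\le\tau\}.$$ The local lens depth is $LLD(x,\tau)=\int_{\mathbb{R}^p\times\mathbb{R}^p}\mathbf{I}((x_1,x_2)\in Z_\tau(x))\,dP(x_1)\,dP(x_2)$. $\Lambda_1$ is the Lebesgue measure of $Z_1(0)$ in $\mathbb{R}^p\times\mathbb{R}^p$. For $0<\tau<\infty$, $f_\tau(x)=\frac{1}{\tau^p\sqrt{\Lambda_1}}\sqrt{LLD(x,\tau)}$. Let $S=\{x:f(x)>0\}$ and $S_\tau=\{x:f_\tau(x)>0\}$. A point $m\in S$ is a mode (resp. an antimode) for $f$ if $\nabla f(m)=0$ and the Hessian matrix $H_f(m)$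 has only negative (resp. positive) eigenvalues; likewise for $f_\tau$ with $S_\tau$ in place of $S$. The density $f$ is $\tau$-centrally symmetric about $\mu\in S$ if $f(\mu+x)=f(\mu-x)$ for all $x\in\mathbb{R}^p$ with $\|x\|\le\tau$. A (not necessarily symmetric) $p\times p$ matrix $G$ is negative (resp. positive) definite if $y^\top Gy<0$ (resp. $>0$) for all $y\in\mathbb{R}^p\setminus\{0\}$. Having continuous partial derivatives in a closed ball means having them on some open set containing that ball. *)

(* Defs.v *)
From HB Require Import structures.
From mathcomp Require Import all_boot all_order all_algebra.
From mathcomp Require Import all_classical all_reals all_analysis.
From mathcomp Require Import complex.

Set Implicit Arguments.
Unset Strict Implicit.
Unset Printing Implicit Defensive.

Import Order.TTheory GRing.Theory Num.Theory.
Import numFieldNormedType.Exports.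

Local Open Scope classical_set_scope.
Local Open Scope ring_scope.

Section measurable_rV.
Context {R : realType} {n : nat}.

Let coors : 'I_n -> 'rV[R]_n -> R := fun i x => x ord0 i.

Let rV_set0 : g_sigma_preimage coors set0.
Proof. exact: sigma_algebra0. Qed.

Let rV_setC A : g_sigma_preimage coors A -> g_sigma_preimage coors (~` A).
Proof. exact: sigma_algebraC. Qed.

Let rV_bigcup (F : _^nat) : (forall i, g_sigma_preimage coors (F i)) ->
  g_sigma_preimage coors (\bigcup_i (F i)).
Proof. exact: sigma_algebra_bigcup. Qed.

(* The sigma-algebra generated by the coordinates, that is the Borel one;
   compare the instance on n.-tuple T in measurable_structure. *)
HB.instance Definition _ := @isMeasurable.Build default_measure_display
  'rV[R]_n (g_sigma_preimage coors) rV_set0 rV_setC rV_bigcup.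

End measurable_rV.

Section lebesgue_rV.
Context {R : realType}.

Lemma measurable_coord n (i : 'I_n) :
  measurable_fun [set: 'rV[R]_n] (fun x => x ord0 i).
Proof.
move=> _ Y mY; rewrite setTI; apply: sub_sigma_algebra => /=.
rewrite -bigcup_seq/=; exists i => /=; first by rewrite mem_index_enum.
by exists Y => //; rewrite setTI.
Qed.

Lemma measurable_fun_rVP d (T : measurableType d) n (f : T -> 'rV[R]_n) :
  (forall i, measurable_fun setT (fun t => f t ord0 i)) ->
  measurable_fun setT f.
Proof.
move=> mf; suff : g_sigma_preimage (fun i t => f t ord0 i) `<=` measurable.
  rewrite (_ : (fun i t => f t ord0 i) =
    (fun i => (fun x : 'rV[R]_n => x ord0 i) \o f))//.
  by rewrite g_sigma_preimage_comp => prefS _ A mA; apply: prefS; exists A.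
apply: smallest_sub; first exact: sigma_algebra_measurable.
rewrite -bigcup_seq/=; apply: bigcup_sub => i _ A [B mB <-].
exact: mf.
Qed.

Definition cons_rV n (z : measurableTypeR R * 'rV[R]_n) : 'rV[R]_n.+1 :=
  \row_i if unlift ord0 i is Some j then z.2 ord0 j else z.1.

Lemma measurable_cons_rV n : measurable_fun setT (@cons_rV n).
Proof.
apply: measurable_fun_rVP => i; under eq_fun do rewrite mxE.
case: unliftP => [j _|_]; last exact: measurable_fst.
exact: (measurableT_comp (measurable_coord j)).
Qed.

HB.instance Definition _ n := isMeasurableFun.Build _ _ _ _ (@cons_rV n)
  (@measurable_cons_rV n).

Definition uncons_rV n (x : 'rV[R]_n.+1) : measurableTypeR R * 'rV[R]_n :=
  (x ord0 ord0, \row_j x ord0 (lift ord0 j)).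

Lemma cons_rVK n : cancel (@cons_rV n) (@uncons_rV n).
Proof.
case=> a x; rewrite /uncons_rV mxE unlift_none /=; congr pair.
by apply/rowP => j; rewrite !mxE liftK.
Qed.

Lemma uncons_rVK n : cancel (@uncons_rV n) (@cons_rV n).
Proof.
move=> x; apply/rowP => i; rewrite mxE.
by case: unliftP => [j ->|->] //=; rewrite mxE.
Qed.

Lemma measurable_uncons_rV n : measurable_fun setT (@uncons_rV n).
Proof.
apply: measurable_fun_pair; first exact: (measurable_coord ord0).
apply: measurable_fun_rVP => i; under eq_fun do rewrite mxE.
exact: measurable_coord.
Qed.

Section cons_measure.
Variables (n : nat) (mu : {sigma_finite_measure set 'rV[R]_n -> \bar R}).

Definition cons_measure : set 'rV[R]_n.+1 -> \bar R :=
  pushforward (lebesgue_measure \x mu)%E (@cons_rV n).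

Let cons_measure0 : cons_measure set0 = 0%E.
Proof. exact: measure0. Qed.

Let cons_measure_ge0 A : (0 <= cons_measure A)%E.
Proof. exact: measure_ge0. Qed.

Let cons_measure_sigma_additive : semi_sigma_additive cons_measure.
Proof. exact: measure_semi_sigma_additive. Qed.

HB.instance Definition _ := isMeasure.Build _ _ _ cons_measure
  cons_measure0 cons_measure_ge0 cons_measure_sigma_additive.

Let cons_measure_sigma_finite : sigma_finite setT cons_measure.
Proof.
have /sigma_finiteP[F [TF ndF Foo]] :=
  sigma_finiteT (@lebesgue_measure R).
have /sigma_finiteP[G [TG ndG Goo]] := sigma_finiteT mu.
exists (fun k => @uncons_rV n @^-1` (F k `*` G k)).
  apply/esym; rewrite -subTset => x _.
  have : (\bigcup_k F k) (uncons_rV x).1 by rewrite -TF.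
  have : (\bigcup_k G k) (uncons_rV x).2 by rewrite -TG.
  move=> [k _ Gkx] [l _ Flx]; exists (maxn k l) => //; split.
    by move: Flx; exact/subsetPset/ndF/leq_maxr.
  by move: Gkx; exact/subsetPset/ndG/leq_maxl.
move=> k; have [mF Fkoo] := Foo k; have [mG Gkoo] := Goo k; split.
  rewrite -[X in measurable X]setTI; apply: measurable_uncons_rV => //.
  exact: measurableX.
rewrite /cons_measure /pushforward -comp_preimage.
rewrite (_ : _ \o _ = id); last by apply/funext => z /=; rewrite cons_rVK.
by rewrite preimage_id product_measure1E// lte_mul_pinfty// ge0_fin_numE.
Qed.

HB.instance Definition _ := Measure_isSigmaFinite.Build _ _ _ cons_measure
  cons_measure_sigma_finite.

End cons_measure.

Fixpoint lebesgue_rV n : {sigma_finite_measure set 'rV[R]_n -> \bar R} :=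
  if n is k.+1 then [the {sigma_finite_measure set _ -> \bar R} of
                     cons_measure (lebesgue_rV k)]
  else [the {sigma_finite_measure set _ -> \bar R} of dirac (0 : 'rV[R]_0)].

Lemma lebesgue_rV_box n (A : 'I_n -> set R) :
    (forall i, measurable (A i)) ->
  lebesgue_rV n [set x | forall i, A i (x ord0 i)] =
  (\prod_(i < n) lebesgue_measure (A i))%E.
Proof.
elim: n A => [|n IHn] A mA.
  rewrite big_ord0 /= diracE mem_set//.
  by case.
rewrite big_ord_recl -IHn//= /cons_measure /pushforward.
pose B := [set x : 'rV[R]_n | forall i, A (lift ord0 i) (x ord0 i)].
have mB : measurable B.
  rewrite (_ : B = \big[setI/setT]_(i < n)
    ((fun x : 'rV[R]_n => x ord0 i) @^-1` A (lift ord0 i))).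
    apply: bigsetI_measurable => i _.
    by rewrite -[X in measurable X]setTI; exact: measurable_coord.
  rewrite -bigcap_seq; apply/seteqP; split=> [x Bx i _|x Bx i]; first exact: Bx.
  by apply: Bx => /=; exact: mem_index_enum.
rewrite -/B -product_measure1E//; last exact: mA.
congr (_ _); apply/seteqP; split=> -[a x] /=.
  move=> Aax; split; first by have := Aax ord0; rewrite mxE unlift_none.
  by move=> i; have := Aax (lift ord0 i); rewrite mxE liftK.
move=> [Aa Bx] i; rewrite mxE.
by case: unliftP => [j ->|->] //=; exact: Bx.
Qed.

End lebesgue_rV.

Section calculus.
Context {R : realType} {p : nat}.
Implicit Types (f : 'rV[R]_p -> R) (x m : 'rV[R]_p) (A : 'M[R]_p).

(* The library's norm `|x| on matrices is the sup norm; it induces the same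
   topology, so open sets and limits below are the usual ones. *)
Definition enorm x : R := Num.sqrt (\sum_(i < p) x ord0 i ^+ 2).

Definition closed_eball x (r : R) : set 'rV[R]_p := [set y | enorm (y - x) <= r].

Definition basis_vec (i : 'I_p) : 'rV[R]_p := delta_mx ord0 i.

Definition partial f (i : 'I_p) : 'rV[R]_p -> R := 'D_(basis_vec i) f.

Definition partial_ex f (i : 'I_p) x : Prop := derivable f x (basis_vec i).

Definition grad f x : 'cV[R]_p := \col_i partial f i x.

Definition hessian f x : 'M[R]_p := \matrix_(i, j) partial (partial f j) i x.

(* 'D_v f has a junk value where the limit does not exist, so the existence of
   the entries of [grad f x] and [hessian f x] has to be required separately. *)
Definition hessian_ex f x : Prop :=
  (forall j, \forall y \near x, partial_ex f j y) /\
  (forall i j, partial_ex (partial f j) i x).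

Definition continuous_partials2_on f (A : set 'rV[R]_p) : Prop :=
  exists U : set 'rV[R]_p, [/\ open U, A `<=` U &
    forall x, U x -> hessian_ex f x /\
      forall i j, {for x, continuous (partial (partial f j) i)}].

(* Eigenvalues are taken in the complex numbers, so that the two conditions are
   never vacuous. In R[i], [z < 0] means that z is real and negative. *)
Definition complex_eigenvalue A (z : R[i]) : bool :=
  eigenvalue (map_mx (real_complex R) A) z.

Definition only_neg_eigenvalues A : Prop :=
  forall z, complex_eigenvalue A z -> z < 0.

Definition only_pos_eigenvalues A : Prop :=
  forall z, complex_eigenvalue A z -> 0 < z.

Definition neg_definite A : Prop :=
  forall y : 'cV[R]_p, y != 0 -> (y^T *m A *m y) ord0 ord0 < 0.

Definition pos_definite A : Prop :=
  forall y : 'cV[R]_p, y != 0 -> 0 < (y^T *m A *m y) ord0 ord0.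

Definition pos_set f : set 'rV[R]_p := [set x | 0 < f x].

Definition mode f m : Prop :=
  [/\ pos_set f m, hessian_ex f m, grad f m = 0 &
      only_neg_eigenvalues (hessian f m)].

Definition antimode f m : Prop :=
  [/\ pos_set f m, hessian_ex f m, grad f m = 0 &
      only_pos_eigenvalues (hessian f m)].

Definition centrally_symmetric f (tau : R) (mu : 'rV[R]_p) : Prop :=
  pos_set f mu /\ forall x, enorm x <= tau -> f (mu + x) = f (mu - x).

Definition Gmx f (x1 x2 : 'rV[R]_p) : 'M[R]_p :=
  f x2 *: hessian f x1 + grad f x1 *m (grad f x2)^T.

End calculus.

Section local_lens_depth.
Context {R : realType} {p : nat}.
Implicit Types (P : probability 'rV[R]_p R) (f : 'rV[R]_p -> R).

(* P is absolutely continuous with respect to Lebesgue, with density f. *)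
Definition is_density P f : Prop :=
  [/\ forall x, 0 <= f x, measurable_fun setT f &
      forall A, measurable A -> P A = (\int[lebesgue_rV p]_(x in A) (f x)%:E)%E].

Definition Zset (tau : \bar R) (x : 'rV[R]_p) : set ('rV[R]_p * 'rV[R]_p) :=
  [set z | Num.max (enorm (x - z.1)) (enorm (x - z.2)) <= enorm (z.1 - z.2) /\
           ((enorm (z.1 - z.2))%:E <= tau)%E].

Definition LLD P (tau : \bar R) (x : 'rV[R]_p) : R :=
  \int[(P \x P)%E]_z \1_(Zset tau x) z.

Definition Lambda1 : R :=
  fine ((lebesgue_rV p \x lebesgue_rV p)%E (Zset 1 0)).

Definition f_tau P (tau : R) (x : 'rV[R]_p) : R :=
  1 / (tau ^+ p * Num.sqrt Lambda1) * Num.sqrt (LLD P tau%:E x).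

End local_lens_depth.

(* Main.v *)
Require Import Defs.
From HB Require Import structures.
From mathcomp Require Import all_boot all_order all_algebra.
From mathcomp Require Import all_classical all_reals all_analysis.
From mathcomp Require Import measurable_realfun complex ring lra.

(** Translating each of the two points by [x] turns the lens depth into an
    integral over a set that no longer depends on [x],
      F(x) = \int_{Z(0)} f(x + u) f(x + v) du dv,
    where Z(0) is the set of pairs (u, v) with
    max(|u|, |v|) <= |u - v| <= tau ([LLD_lens_int]). Both points of such a pair
    lie in the closed ball of radius tau, so for [x] close to [m] the integrand
    only sees [f] on the open set where it is twice continuously
    differentiable; there everything is bounded, uniformly in [x], by
    compactness of the ball, and one may differentiate twice under the integral
    sign ([is_derive_lens_int]).

    The gradient of F at [m] is a sum of integrals of (d_i f)(m + u) f(m + v).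
    Central symmetry makes f even and d_i f odd about [m] on the ball, and Z(0)
    is invariant under (u, v) |-> (- u, - v), so these integrals vanish
    ([lens_grad_eq0]). The Hessian of F at [m] consists of
    four terms; since Z(0) is also invariant under exchanging u and v they pair
    up into twice the integral of G_f(m + u, m + v) ([lens_hessE]). Integrating
    the quadratic form of G_f, of constant strict sign, over a set of positive
    measure gives the sign of the quadratic form of the Hessian of F
    ([lens_hess_form_sign]).

    Finally f_tau is a positive multiple of the square root of F, and F > 0 near
    [m] because f(m) > 0. As the gradient of F vanishes at [m], so does that of
    f_tau, and the Hessian of f_tau at [m] is a positive multiple of that of F
    ([sqrt_hessian]). It is symmetric (Schwarz, [partialC], and the exchange of
    u and v), so its complex eigenvalues are real and their sign is that of the
    quadratic form ([symmetric_eigenvalue]).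

    The measure-theoretic input is that the product of P with itself has density
    f(u) f(v) ([product_density]) and that the Lebesgue measure is invariant
    under translations and point reflections ([measure_preserving_affine]); both
    follow from uniqueness of measures with prescribed values on rectangles. *)

Set Implicit Arguments.
Unset Strict Implicit.
Unset Printing Implicit Defensive.

Import Order.TTheory GRing.Theory Num.Theory.
Import numFieldNormedType.Exports.

Local Open Scope classical_set_scope.
Local Open Scope ring_scope.

(** * The Euclidean norm and Borel sets of row vectors *)

Section euclidean.
Context {R : realType} {n : nat}.
Implicit Types x y : 'rV[R]_n.

Lemma enorm_ge0 x : 0 <= enorm x.
Proof. exact: sqrtr_ge0. Qed.

Lemma enormZ (a : R) x : enorm (a *: x) = `|a| * enorm x.
Proof.
rewrite /enorm; under eq_bigr do rewrite mxE exprMn.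
by rewrite -mulr_sumr sqrtrM ?sqr_ge0// sqrtr_sqr.
Qed.

Lemma enormN x : enorm (- x) = enorm x.
Proof. by rewrite -scaleN1r enormZ normrN1 mul1r. Qed.

Lemma enorm0 : enorm (0 : 'rV[R]_n) = 0.
Proof. by rewrite -(scale0r 0) enormZ normr0 mul0r. Qed.

Lemma coord_le_enorm x i : `|x ord0 i| <= enorm x.
Proof.
rewrite -sqrtr_sqr ler_wsqrtr// (bigD1 i)//= lerDl.
by apply: sumr_ge0 => j _; exact: sqr_ge0.
Qed.

Lemma enorm_continuous : continuous (@enorm R n).
Proof.
move=> x; apply: (@continuous_comp _ _ _ _ (@Num.sqrt R)); last exact: sqrt_continuous.
rewrite (_ : (fun x => _) = \sum_(i < n) (fun x : 'rV[R]_n => x ord0 i ^+ 2)); last first.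
  by apply/funext => y; rewrite fct_sumE.
apply: (big_ind (fun f : 'rV[R]_n -> R => {for x, continuous f})) => [|f g cf cg|i _].
- exact: (@cst_continuous _ _ 0 x).
- exact: continuousD.
by apply: (@continuous_comp _ _ _ (fun x : 'rV[R]_n => x ord0 i) (fun r : R => r ^+ 2));
  [exact: coord_continuous | exact: exprn_continuous].
Qed.

Lemma compact_closed_eball x (r : R) : compact (closed_eball x r).
Proof.
apply: bounded_closed_compact; last first.
  rewrite [X in closed X](_ : _ = (fun y => enorm (y - x)) @^-1` [set a : R | a <= r])//.
  apply: closed_comp => [y _|]; last exact: closed_le.
  apply: continuous_comp; last exact: enorm_continuous.
  by apply: (@continuousB _ _ _ id (cst x)); [by move=> ? | exact: (@cst_continuous _ _ x)].
exists (r + `|x|); split; first exact: num_real.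
move=> M rM y /= yr.
have -> : y = (y - x) + x by rewrite subrK.
apply: le_trans (ler_normD _ _) _; apply: le_trans (ltW rM); rewrite lerD2r.
apply: le_trans yr; rewrite [leLHS]/Num.norm/= mx_normrE.
apply/bigmax_leP; split=> [|[i j] _] /=; first exact: enorm_ge0.
by rewrite ord1; exact: coord_le_enorm.
Qed.

End euclidean.

Section borel.
Context {R : realType} {n : nat}.

Lemma measurable_box (A : 'I_n -> set R) : (forall i, measurable (A i)) ->
  measurable [set x : 'rV[R]_n | forall i, A i (x ord0 i)].
Proof.
move=> mA; rewrite (_ : [set x | _] = \big[setI/setT]_(i < n)
    ((fun x : 'rV[R]_n => x ord0 i) @^-1` A i)).
  apply: bigsetI_measurable => i _.
  by rewrite -[X in measurable X]setTI; exact: measurable_coord.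
rewrite -bigcap_seq; apply/seteqP; split=> [x Bx i _|x Bx i]; first exact: Bx.
by apply: Bx => /=; exact: mem_index_enum.
Qed.

(** The sigma-algebra is generated by the coordinates; an open set belongs to it
    as a countable union of open cubes with rational centre and side [2 / k.+1]. *)
Lemma open_measurable_rV (A : set 'rV[R]_n) : open A -> measurable A.
Proof.
move=> oA.
pose side (q : 'rV[rat]_n * nat) (i : 'I_n) : set R :=
  `](ratr (q.1 ord0 i) - q.2.+1%:R^-1), (ratr (q.1 ord0 i) + q.2.+1%:R^-1)[%classic.
pose box q := [set x : 'rV[R]_n | forall i, side q i (x ord0 i)].
rewrite (_ : A = \bigcup_(q in [set q | box q `<=` A]) box q); last first.
  apply/seteqP; split=> [x Ax|x [q] /=]; last by apply.
  have [e /= e0 xeA] : exists2 e : R, 0 < e & ball x e `<=` A.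
    by apply/nbhs_ballP/open_nbhs_nbhs.
  have [k [d [dE d0 ke]]] : exists k (d : R), [/\ k.+1%:R^-1 = d, 0 < d & d < e / 2].
    have e2 : 0 < e / 2 by lra.
    have [k _ /(_ _ (leqnn k))/= ke] := near_infty_natSinv_lt (PosNum e2).
    by exists k, k.+1%:R^-1; split => //; rewrite invr_gt0.
  have qx i : exists q : rat, ratr q \in `](x ord0 i - d), (x ord0 i + d)[.
    by apply: rat_in_itvoo; lra.
  have [q /= hq] := choice qx.
  exists (\row_i q i, k) => /=.
    move=> y /= yq; apply: xeA; split=> // i j; rewrite ord1.
    have := yq j; have := hq j.
    rewrite /side/= !in_itv/= mxE dE => /andP[q1 q2] /andP[q3 q4].
    rewrite /ball/= ltr_norml; apply/andP; split; lra.
  move=> i; have := hq i.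
  by rewrite /side/= !in_itv/= mxE dE => /andP[q1 q2]; apply/andP; split; lra.
rewrite bigcup_mkcond; apply: countable_bigcupT_measurable => // q.
case: ifP => // _; apply: (@measurable_box (side q)) => i.
exact: measurable_itv.
Qed.


Lemma measurable_fun_continuous_on (U : set 'rV[R]_n) (f : 'rV[R]_n -> R) :
  open U -> (forall x, U x -> {for x, continuous f}) -> measurable_fun U f.
Proof.
move=> oU cf mU; apply: (measurability _ (measurable_realfun.RGenOInfty.measurableE R)) => //.
move=> _ [_ [a ->] <-].
apply: open_measurable_rV; rewrite openE => x [Ux /= fx].
apply: filterI; first by apply: open_nbhs_nbhs.
apply: cf => //; apply: open_nbhs_nbhs; split => //.
Qed.

Lemma measurable_enorm : measurable_fun setT (@enorm R n).
Proof.
apply: measurable_fun_continuous_on; first exact: openT.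
by move=> x _; exact: enorm_continuous.
Qed.

Lemma measurable_addr_rV d (T : measurableType d) (f g : T -> 'rV[R]_n) :
  measurable_fun setT f -> measurable_fun setT g ->
  measurable_fun setT (fun t => f t + g t).
Proof.
move=> mf mg; apply: measurable_fun_rVP => i.
rewrite (_ : (fun t => _) = (fun t => f t ord0 i) \+ (fun t => g t ord0 i)).
  by apply: measurable_funD;
    [exact: (measurableT_comp (measurable_coord i) mf)|
     exact: (measurableT_comp (measurable_coord i) mg)].
by apply/funext => t; rewrite mxE.
Qed.

Lemma measurable_scale_rV d (T : measurableType d) (a : R) (f : T -> 'rV[R]_n) :
  measurable_fun setT f -> measurable_fun setT (fun t => a *: f t).
Proof.
move=> mf; apply: measurable_fun_rVP => i.
rewrite (_ : (fun t => _) = (fun t => a * f t ord0 i)).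
  apply: measurable_funM => //.
  exact: (measurableT_comp (measurable_coord i) mf).
by apply/funext => t; rewrite mxE.
Qed.

End borel.

(** * Maps preserving the Lebesgue measure, and the density of the product *)

Definition measure_preserving {R : realType} d (T : measurableType d)
    (mu : {measure set T -> \bar R}) (phi : T -> T) :=
  measurable_fun setT phi /\
  forall X, measurable X -> mu (phi @^-1` X) = mu X.

Section measure_preserving.
Context {R : realType} d (T : measurableType d).
Variables (mu : {measure set T -> \bar R}) (phi : T -> T).
Hypothesis mphi : measure_preserving mu phi.
Local Open Scope ereal_scope.

Lemma ge0_integral_measure_preserving (B : set T) (g : T -> \bar R) :
  measurable B -> measurable_fun B g -> (forall x, B x -> 0 <= g x) ->
  \int[mu]_(x in B) g x = \int[mu]_(x in phi @^-1` B) g (phi x).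
Proof.
case: mphi => mf mpres mB mg g0.
have := @ge0_integral_pushforward _ _ _ _ _ _ mf mu B g mB mg.
move=> <-; last by move=> y; rewrite inE => /g0.
by apply: eq_measure_integral => /= A mA _; rewrite /pushforward mpres.
Qed.

Lemma integral_measure_preserving (B : set T) (g : T -> \bar R) :
  measurable B -> measurable_fun B g ->
  \int[mu]_(x in B) g x = \int[mu]_(x in phi @^-1` B) g (phi x).
Proof.
move=> mB mg; rewrite integralE [RHS]integralE; congr (_ - _).
- rewrite ge0_integral_measure_preserving//; last exact: measurable_funepos.
  by apply: eq_integral => x _; rewrite !funeposE.
- rewrite ge0_integral_measure_preserving//; last exact: measurable_funeneg.
  by apply: eq_integral => x _; rewrite !funenegE.
Qed.

Lemma Rintegral_measure_preserving (B : set T) (g : T -> R) :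
  measurable B -> measurable_fun B g ->
  (\int[mu]_(x in B) g x = \int[mu]_(x in phi @^-1` B) g (phi x))%R.
Proof.
move=> mB mg; rewrite /Rintegral; congr fine.
by rewrite integral_measure_preserving//; exact/measurable_EFinP.
Qed.

End measure_preserving.

Lemma measure_preserving_product {R : realType} d1 d2
    (T1 : measurableType d1) (T2 : measurableType d2)
    (m1 : {sigma_finite_measure set T1 -> \bar R})
    (m2 : {sigma_finite_measure set T2 -> \bar R}) phi1 phi2 :
  measure_preserving m1 phi1 -> measure_preserving m2 phi2 ->
  measure_preserving (m1 \x m2)%E (fun z => (phi1 z.1, phi2 z.2)).
Proof.
move=> [mf1 pres1] [mf2 pres2].
have mphi : measurable_fun setT (fun z : T1 * T2 => (phi1 z.1, phi2 z.2)).
  by apply: measurable_fun_pair;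
    [exact: (measurableT_comp mf1)|exact: (measurableT_comp mf2)].
split=> // X mX.
pose mp := isMeasurableFun.Build _ _ _ _ _ mphi.
pose phi : {mfun _ >-> _} := HB.pack (fun z : T1 * T2 => (phi1 z.1, phi2 z.2)) mp.
apply/esym; apply: (@product_measure_unique _ _ _ _ _ m1 m2
  [the {measure set _ -> \bar R} of pushforward (m1 \x m2)%E phi]) => // A B mA mB.
rewrite -(pres1 _ mA) -(pres2 _ mB) -product_measure1E//.
  by rewrite -[X in measurable X]setTI; exact: mf1.
by rewrite -[X in measurable X]setTI; exact: mf2.
Qed.

Lemma measure_preserving_swap {R : realType} d (T : measurableType d)
    (mu : {sigma_finite_measure set T -> \bar R}) :
  measure_preserving (mu \x mu)%E (fun z => (z.2, z.1)).
Proof.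
have mphi : measurable_fun setT (fun z : T * T => (z.2, z.1)).
  exact: measurable_fun_pair.
split=> // X mX.
pose mp := isMeasurableFun.Build _ _ _ _ _ mphi.
pose phi : {mfun _ >-> _} := HB.pack (fun z : T * T => (z.2, z.1)) mp.
apply/esym; apply: (@product_measure_unique _ _ _ _ _ mu mu
  [the {measure set _ -> \bar R} of pushforward (mu \x mu)%E phi]) => // A B mA mB.
rewrite /= /pushforward (_ : _ @^-1` _ = B `*` A); last first.
  by apply/seteqP; split=> -[a b] [].
by rewrite muleC product_measure1E.
Qed.

Section lebesgue_rV_preserving.
Context {R : realType}.

(** Boxes are stable under intersection, generate the sigma-algebra, and cubes of
    finite measure exhaust the space. *)
Lemma lebesgue_rV_unique n (mu : {measure set 'rV[R]_n -> \bar R}) :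
  (forall A, (forall i, measurable (A i)) ->
     mu [set x | forall i, A i (x ord0 i)] =
     (\prod_(i < n) lebesgue_measure (A i))%E) ->
  forall X, measurable X -> lebesgue_rV n X = mu X.
Proof.
move=> muE X mX.
pose box A := [set x : 'rV[R]_n | forall i, A i (x ord0 i)].
pose G := [set B | exists A : 'I_n -> set R, (forall i, measurable (A i)) /\ B = box A].
pose g k := box (fun=> `[- k%:R, k%:R]%classic : set R).
have mg k : measurable (`[- k%:R, k%:R]%classic : set R).
  exact: measurable_itv.
apply: (measure_unique G g) => //.
- apply/seteqP; split.
    apply: smallest_sub; first exact: smallest_sigma_algebra.
    rewrite -bigcup_seq/=; apply: bigcup_sub => i _ _ [B mB <-].
    apply: sub_sigma_algebra.
    exists (fun j => if j == i then B else setT); split.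
      by move=> j; case: ifP.
    rewrite setTI; apply/seteqP; split=> x /=.
      by move=> Bx j; case: ifPn => // /eqP ->.
    by move=> /(_ i); rewrite eqxx.
  apply: smallest_sub; first exact: sigma_algebra_measurable.
  by move=> _ [A [mA ->]]; exact: measurable_box.
- move=> _ _ [A [mA ->]] [B [mB ->]].
  exists (fun i => A i `&` B i); split; first by move=> i; exact: measurableI.
  apply/seteqP; split=> x /=; first by move=> [Ax Bx] i; split.
  by move=> ABx; split=> i; have [] := ABx i.
- by move=> k; exists (fun=> `[- k%:R, k%:R]%classic).
- rewrite -subTset => x _.
  have [k _ xk] : \forall k \near \oo, `|x| <= k%:R.
    exact: nbhs_infty_ger.
  exists k => // i /=; rewrite in_itv/= -ler_norml.
  apply: le_trans (xk k (leqnn k)).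
  rewrite [leRHS]/Num.norm/= mx_normrE.
  by apply: (le_bigmax _ (fun i : 'I_1 * 'I_n => `|x i.1 i.2|) (ord0, i)).
- move=> A [B [mB ->]]; rewrite muE//; exact: lebesgue_rV_box.
move=> k; have := @lebesgue_rV_box R n (fun=> `[- k%:R, k%:R]%classic) (fun=> mg k).
move=> /(eq_ind_r (fun y => (y < +oo)%E)); apply.
rewrite ltey_eq prode_fin_num// => i _.
by rewrite /= lebesgue_measure_itv/=; case: ifP.
Qed.

Lemma lebesgue_measure_affine (a : R) (b : bool) (A : set R) : measurable A ->
  lebesgue_measure ((fun y => a + (-1) ^+ b * y) @^-1` A) = lebesgue_measure A.
Proof.
move=> mA; apply/esym.
pose phi0 : measurableTypeR R -> measurableTypeR R := fun y => a + (-1) ^+ b * y.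
have mphi : measurable_fun setT phi0.
  by apply: measurable_funD => //; exact: measurable_funM.
pose mp := isMeasurableFun.Build _ _ _ _ _ mphi.
pose phi : {mfun measurableTypeR R >-> measurableTypeR R} :=
  HB.pack phi0 mp.
apply: (@lebesgue_measure_unique R
  [the {measure set _ -> \bar R} of pushforward lebesgue_measure phi]) => //.
move=> _ [[x y] _ <-] /=; rewrite /pushforward.
rewrite /phi/= /phi0 {phi mp mphi phi0}; case: b.
  rewrite (_ : _ @^-1` _ = `[a - y, a - x[%classic); last first.
    apply/seteqP; split=> z /=; rewrite !in_itv/= => /andP[? ?]; apply/andP; split; lra.
  rewrite !lebesgue_measure_itv/= !lte_fin.
  rewrite ltrD2l ltrN2; case: ifP => // _.
  by rewrite -!EFinB; congr (_%:E); ring.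
rewrite (_ : _ @^-1` _ = `]x - a, y - a]%classic); last first.
  apply/seteqP; split=> z /=; rewrite !in_itv/= => /andP[? ?]; apply/andP; split; lra.
rewrite !lebesgue_measure_itv/= !lte_fin.
rewrite ltrD2r; case: ifP => // _.
by rewrite -!EFinB; congr (_%:E); ring.
Qed.

(** The sign is a boolean so that one statement covers the translations and the
    reflections through a point. *)
Lemma measure_preserving_affine n (c : 'rV[R]_n) (b : bool) :
  measure_preserving (lebesgue_rV n) (fun x => c + (-1) ^+ b *: x).
Proof.
have mphi : measurable_fun setT (fun x : 'rV[R]_n => c + (-1) ^+ b *: x).
  by apply: measurable_addr_rV => //; exact: measurable_scale_rV.
split=> // X mX; apply/esym.
pose mp := isMeasurableFun.Build _ _ _ _ _ mphi.
pose phi : {mfun 'rV[R]_n >-> 'rV[R]_n} :=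
  HB.pack (fun x : 'rV[R]_n => c + (-1) ^+ b *: x) mp.
apply: (@lebesgue_rV_unique n
  [the {measure set _ -> \bar R} of pushforward (lebesgue_rV n) phi]) => //.
move=> A mA /=; rewrite /pushforward.
pose B i : set R := (fun y : R => c ord0 i + (-1) ^+ b * y) @^-1` A i.
transitivity (\prod_(i < n) lebesgue_measure (B i))%E; last first.
  by apply: eq_bigr => i _; exact: lebesgue_measure_affine.
rewrite -lebesgue_rV_box; last first.
  move=> i; rewrite -[X in measurable X]setTI.
  have mB : measurable_fun setT (fun y : R => c ord0 i + (-1) ^+ b * y).
    by apply: measurable_funD => //; exact: measurable_funM.
  exact: mB.
congr (lebesgue_rV _ _); apply/seteqP.
by split=> x /= + i => /(_ i); rewrite /B /= !mxE.
Qed.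

End lebesgue_rV_preserving.

Section density_product.
Context {R : realType} {n : nat}.
Local Open Scope ereal_scope.

(** By uniqueness of the product measure only rectangles have to be compared, and
    there Tonelli's theorem factors the integral of f(u) f(v). *)
Lemma product_density (P : probability 'rV[R]_n R) (f : 'rV[R]_n -> R) :
  is_density P f -> forall X, measurable X ->
  (P \x P) X =
  \int[lebesgue_rV n \x lebesgue_rV n]_(z in X) (f z.1 * f z.2)%:E.
Proof.
case=> f0 mf Pf X mX.
set mu := lebesgue_rV n.
have mff : measurable_fun setT (fun z : 'rV[R]_n * 'rV[R]_n => (f z.1 * f z.2)%:E).
  apply/measurable_EFinP; apply: measurable_funM.
    exact: (measurableT_comp mf measurable_fst).
  exact: (measurableT_comp mf measurable_snd).
have ff0 z : 0 <= (f z.1 * f z.2)%:E by rewrite lee_fin mulr_ge0.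
pose nu A := \int[mu \x mu]_(z in A) (f z.1 * f z.2)%:E.
have nu0 : nu set0 = 0 by rewrite /nu integral_set0.
have nuge0 A : 0 <= nu A by exact: integral_ge0.
have nusa : semi_sigma_additive nu.
  exact: semi_sigma_additive_nng_induced.
pose numeas : {measure set _ -> \bar R} :=
  HB.pack nu (isMeasure.Build _ _ _ nu nu0 nuge0 nusa).
apply: (@product_measure_unique _ _ _ _ _ P P numeas) => // A B mA mB.
rewrite /= /nu integral_mkcond.
rewrite fubini_tonelli1//; last 2 first.
- exact: (iffLR (measurable_restrictT _ (measurableX mA mB)) (measurable_funTS mff)).
- by move=> z; rewrite patchE; case: ifP.
have mfE D : measurable_fun D (fun x => (f x)%:E).
  by apply/measurable_EFinP; exact: measurable_funTS.
transitivity (\int[mu]_(x in A) ((f x)%:E * P B)).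
  rewrite [RHS]integral_mkcond; apply: eq_integral => x _.
  rewrite [RHS]patchE; case: ifPn => xA.
    rewrite Pf// -ge0_integralZl_EFin//; last by move=> y _; rewrite lee_fin.
    rewrite [RHS]integral_mkcond; apply: eq_integral => y _.
    by rewrite !patchE in_setX /= xA.
  apply: integral0_eq => y _.
  by rewrite patchE in_setX /= (negbTE xA).
rewrite ge0_integralZr//; first by rewrite -Pf.
by move=> y _; rewrite lee_fin.
Qed.

End density_product.

(** * Partial derivatives: continuity and Schwarz's theorem *)

Section along_lines.
Context {R : realType} {n : nat}.
Implicit Types (f g : 'rV[R]_n -> R) (x v : 'rV[R]_n).

(** Reduces directional derivatives to functions of one real variable, where the
    mean value theorem and the chain rule are available. *)
Lemma is_derive_line f x v (t d : R) :
  is_derive (x + t *: v) v f d <-> is_derive t (1 : R) (fun s => f (x + s *: v)) d.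
Proof.
pose p h : R := h^-1 *: ((f \o shift (x + t *: v)) (h *: v) - f (x + t *: v)).
pose q h : R :=
  h^-1 *: (((fun s => f (x + s *: v)) \o shift t) (h *: (1 : R)) - f (x + t *: v)).
have pq : p = q.
  apply/funext => h; rewrite /p /q /=; congr (_ *: (f _ - _)).
  by rewrite [h *: (1 : R)]mulr1 scalerDl addrCA.
split=> -[D1 D2].
  have D1' : cvg (q @ 0^') by rewrite -pq.
  have D2' : lim (q @ 0^') = d by rewrite -pq.
  by split.
have D1' : cvg (p @ 0^') by rewrite pq.
have D2' : lim (p @ 0^') = d by rewrite pq.
by split.
Qed.

Lemma mx_norm_coord x i : `|x ord0 i| <= `|x|.
Proof.
rewrite [leRHS]/Num.norm/= mx_normrE.
by apply: (le_bigmax _ (fun i : 'I_1 * 'I_n => `|x i.1 i.2|) (ord0, i)).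
Qed.

Lemma mx_norm_le x (r : R) : 0 <= r -> (forall i, `|x ord0 i| <= r) -> `|x| <= r.
Proof.
move=> r0 xr; rewrite [leLHS]/Num.norm/= mx_normrE.
by apply/bigmax_leP; split=> [//|[i j] _] /=; rewrite ord1.
Qed.

Lemma mx_norm_basis_vec i : `|basis_vec i : 'rV[R]_n| <= 1.
Proof.
apply: mx_norm_le => // j; rewrite mxE eqxx /=.
by case: (j == i); rewrite ?normr1 ?normr0.
Qed.

Lemma MVT_norm_le (phi dphi : R -> R) (a b M : R) : 0 <= M ->
  (forall t, Num.min a b <= t <= Num.max a b ->
     is_derive t (1 : R) phi (dphi t) /\ `|dphi t| <= M) ->
  `|phi b - phi a| <= M * `|b - a|.
Proof.
move=> M0; wlog ab : a b / a <= b.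
  move=> H dphiM; have [ab|/ltW ba] := leP a b; first exact: H.
  by rewrite distrC (distrC b); apply: H => //; rewrite minC maxC.
rewrite (min_idPl ab) (max_idPr ab) => dphiM.
have [||c cab ->] := @MVT_segment R phi dphi a b ab.
- by move=> t; rewrite in_itv/= => /andP[/ltW at_ /ltW tb]; apply dphiM; rewrite at_.
- apply: derivable_within_continuous => t; rewrite in_itv/= => tab.
  by have [[]] := dphiM t tab.
rewrite normrM ler_wpM2r//; apply dphiM.
by rewrite in_itv/= in cab.
Qed.

(** Change one coordinate at a time: between two corners of the path the mean
    value theorem applies, and all the points that it meets are as close to [x]
    as [y] is. *)
Lemma bounded_partials_continuous g x (M : R) :
  (\forall y \near x, forall i, partial_ex g i y /\ `|partial g i y| <= M) ->
  {for x, continuous g}.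
Proof.
move=> /nbhs_ballP[e /= e0 He].
have M0 : 0 <= Num.max 0 M by rewrite le_max lexx.
suff lip y : ball x e y -> `|g y - g x| <= n%:R * (Num.max 0 M * `|y - x|).
  move=> A /nbhs_ballP[eps /= eps0 epsA].
  (* The summand 1 only keeps the divisor positive. *)
  have C0 : 0 < n%:R * Num.max 0 M + 1 by rewrite ltr_wpDl// mulr_ge0.
  apply/nbhs_ballP; exists (Num.min e (eps / 2 / (n%:R * Num.max 0 M + 1))) => /=.
    by rewrite lt_min e0 !divr_gt0.
  move=> y xy; have {xy}[xy yx] : ball x e y /\ `|y - x| <= eps / 2 / (n%:R * Num.max 0 M + 1).
    move: xy; rewrite -!ball_normE /= lt_min => /andP[-> /ltW].
    by rewrite distrC.
  apply: epsA; rewrite -ball_normE /= distrC.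
  apply: (@le_lt_trans _ _ (eps / 2)); last by rewrite gtr_pMr// invf_lt1// ltr1n.
  apply: le_trans (lip y xy) _.
  rewrite mulrA; apply: (@le_trans _ _ ((n%:R * Num.max 0 M + 1) * `|y - x|)).
    by rewrite ler_wpM2r// lerDl.
  by rewrite mulrC -ler_pdivlMr.
move=> xy.
have yx : `|y - x| < e by move: xy; rewrite -ball_normE /= distrC.
(* The corner [q k] has its first [k] coordinates from [y], the others from [x]. *)
pose q k := \row_j (if (j < k)%N then y ord0 j else x ord0 j) : 'rV[R]_n.
suff H k : (k <= n)%N -> `|g (q k) - g x| <= k%:R * (Num.max 0 M * `|y - x|).
  have := H n (leqnn n); rewrite (_ : q n = y)//.
  by apply/rowP => j; rewrite mxE ltn_ord.
elim: k => [_|k IH kn].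
  rewrite mul0r (_ : q 0%N = x) ?subrr ?normr0//.
  by apply/rowP => j; rewrite mxE ltn0.
rewrite -[g _](subrK (g (q k))) -addrA -natr1 mulrDl mul1r.
rewrite [leRHS]addrC; apply: le_trans (ler_normD _ _) _.
apply: lerD; last by apply: IH; exact: ltnW.
pose i := Ordinal kn; pose d := y ord0 i - x ord0 i.
have dle : `|d| <= `|y - x| by have := mx_norm_coord (y - x) i; rewrite !mxE.
have qS : q k.+1 = q k + d *: basis_vec i.
  apply/rowP => j; rewrite !mxE eqxx /= ltnS leq_eqVlt.
  have [->|ji] := eqVneq j i; first by rewrite eqxx ltnn /= mulr1 addrC subrK.
  rewrite (_ : (_ == k) = false) ?mulr0 ?addr0//.
  by apply: contraNF ji => /eqP jk; apply/eqP/val_inj.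
have := @MVT_norm_le (fun t => g (q k + t *: basis_vec i))
  (fun t => partial g i (q k + t *: basis_vec i)) 0 d _ M0.
rewrite scale0r addr0 -qS subr0 => H; apply: le_trans (H _) _; last by rewrite ler_wpM2l.
move=> t td; have [|pe pM] := He (q k + t *: basis_vec i) _ i; last first.
  split; first by apply/is_derive_line; exact/derivableP.
  by rewrite le_max pM orbT.
rewrite -ball_normE /=; apply: le_lt_trans yx; apply: mx_norm_le => // j.
have := mx_norm_coord (y - x) j; rewrite !mxE eqxx /=.
have [->|ji] := eqVneq j i.
  rewrite ltnn mulr1 => _; apply: le_trans dle.
  rewrite opprD addrA subrr sub0r normrN.
  move: td; case: (leP 0 d) => d0 /andP[t0 td].
    by rewrite !ger0_norm.
  by rewrite !ler0_norm ?lerN2// ltW.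
rewrite mulr0 addr0; case: ifP => _; first by rewrite distrC.
by rewrite subrr normr0.
Qed.

Lemma continuous_partials_continuous (U : set 'rV[R]_n) g : open U ->
  (forall x, U x -> forall i,
     partial_ex g i x /\ {for x, continuous (partial g i)}) ->
  forall x, U x -> {for x, continuous g}.
Proof.
move=> oU Ug x Ux.
pose M := \sum_i (`|partial g i x| + 1).
apply: (@bounded_partials_continuous _ _ M).
have Un : nbhs x U by exact: open_nbhs_nbhs.
have bnd i : nbhs x (fun y => `|partial g i y| <= M).
  have [_ ci] := Ug x Ux i.
  have : nbhs x (partial g i @^-1` ball (partial g i x) 1).
    by apply: ci; exact: nbhsx_ballx.
  apply: filterS => y; rewrite -ball_normE /= => yx.
  have iM : `|partial g i x| + 1 <= M.
    by rewrite /M (bigD1 i)//= lerDl; apply: sumr_ge0 => j _; rewrite addr_ge0.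
  apply: le_trans iM.
  rewrite -[partial g i y](subrK (partial g i x)) addrC.
  apply: le_trans (ler_normD _ _) _; rewrite lerD2l distrC; exact: ltW.
have bnda : nbhs x (fun y => forall i, `|partial g i y| <= M).
  exact: (@filter_forall _ _ (fun i y => `|partial g i y| <= M) (nbhs x) _ bnd).
apply: filterS2 Un bnda => y Uy yM i; split => //.
by have [] := Ug y Uy i.
Qed.

(** The second difference of [g] over a small square, read as a difference of
    differences in either direction. *)
Lemma second_difference (U : set 'rV[R]_n) g x (e : R) i j :
  0 < e -> ball x e `<=` U ->
  (forall y, U y -> partial_ex g i y /\ partial_ex (partial g i) j y) ->
  forall h, 0 < h -> h + h < e -> exists2 y, `|y - x| <= h + h &
    g (x + h *: basis_vec i + h *: basis_vec j) - g (x + h *: basis_vec i)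
    - (g (x + h *: basis_vec j) - g x) = h * h * partial (partial g i) j y.
Proof.
move=> e0 xeU Ug h h0 he.
have inU s t : 0 <= s <= h -> 0 <= t <= h ->
    `|(x + s *: basis_vec i + t *: basis_vec j) - x| <= h + h.
  move=> /andP[s0 sh] /andP[t0 th]; rewrite addrAC [x + _ - x]addrAC subrr add0r.
  apply: le_trans (ler_normD _ _) _; rewrite !normrZ !ger0_norm//.
  apply: lerD.
    by rewrite -[leRHS]mulr1; apply: ler_pM => //; exact: mx_norm_basis_vec.
  by rewrite -[leRHS]mulr1; apply: ler_pM => //; exact: mx_norm_basis_vec.
have UP y : `|y - x| <= h + h -> U y.
  by move=> yx; apply: xeU; rewrite -ball_normE /= distrC; exact: le_lt_trans he.
have Dg y : `|y - x| <= h + h -> is_derive y (basis_vec i) g (partial g i y).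
  by move=> /UP/Ug[pg _]; exact: derivableP.
have Dgi y : `|y - x| <= h + h ->
    is_derive y (basis_vec j) (partial g i) (partial (partial g i) j y).
  by move=> /UP/Ug[_ pg]; exact: derivableP.
have h0h : 0 <= h <= h by rewrite (ltW h0) lexx.
have z0h : (0 : R) <= 0 <= h by rewrite lexx (ltW h0).
(* First difference in direction [j], as a function of the position along [i]. *)
pose phi s := g (x + h *: basis_vec j + s *: basis_vec i) - g (x + s *: basis_vec i).
pose dphi s := partial g i (x + h *: basis_vec j + s *: basis_vec i)
               - partial g i (x + s *: basis_vec i).
have Dphi s : 0 <= s <= h -> is_derive s (1 : R) phi (dphi s).
  move=> sh; have D1 : is_derive s (1 : R)
      (fun s => g (x + h *: basis_vec j + s *: basis_vec i))
      (partial g i (x + h *: basis_vec j + s *: basis_vec i)).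
    by apply/is_derive_line; apply: Dg; rewrite [x + _ + _]addrAC; exact: inU.
  have D2 : is_derive s (1 : R) (fun s => g (x + s *: basis_vec i))
      (partial g i (x + s *: basis_vec i)).
    by apply/is_derive_line; apply: Dg; have := inU s 0 sh z0h; rewrite scale0r addr0.
  exact: (is_deriveB D1 D2).
have [||s sh phiE] := @MVT_segment R phi dphi 0 h (ltW h0).
- by move=> s; rewrite in_itv/= => /andP[s0 sh]; apply: Dphi; rewrite !ltW.
- by apply: derivable_within_continuous => s; rewrite in_itv/= => /Dphi[].
rewrite in_itv/= in sh.
pose psi t := partial g i (x + s *: basis_vec i + t *: basis_vec j).
pose dpsi t := partial (partial g i) j (x + s *: basis_vec i + t *: basis_vec j).
have Dpsi t : 0 <= t <= h -> is_derive t (1 : R) psi (dpsi t).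
  by move=> th; apply/is_derive_line; apply: Dgi; exact: inU.
have [||t th psiE] := @MVT_segment R psi dpsi 0 h (ltW h0).
- by move=> t; rewrite in_itv/= => /andP[t0 th]; apply: Dpsi; rewrite !ltW.
- by apply: derivable_within_continuous => t; rewrite in_itv/= => /Dpsi[].
rewrite in_itv/= in th.
exists (x + s *: basis_vec i + t *: basis_vec j); first exact: inU.
move: phiE psiE; rewrite /phi /dphi /psi /dpsi !scale0r !addr0 !subr0 => phiE psiE.
have -> : x + h *: basis_vec i + h *: basis_vec j = x + h *: basis_vec j + h *: basis_vec i.
  by rewrite addrAC.
rewrite phiE addrAC psiE; ring.
Qed.

Lemma dist_le_halves (a b c d eps : R) : c = d ->
  `|a - c| < eps / 2 -> `|b - d| < eps / 2 -> `|a - b| <= eps.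
Proof.
move=> ->; rewrite !ltr_norml => /andP[? ?] /andP[? ?].
by rewrite ler_norml; apply/andP; split; lra.
Qed.

(** Both mixed derivatives are limits of the same second difference divided by
    the area of the square. *)
Lemma partialC (U : set 'rV[R]_n) g i j : open U ->
  (forall x, U x -> hessian_ex g x /\
     forall i j, {for x, continuous (partial (partial g j) i)}) ->
  forall x, U x -> partial (partial g i) j x = partial (partial g j) i x.
Proof.
move=> oU Ug x Ux; apply/eqP; rewrite -subr_eq0 -normr_le0; apply/ler_addgt0Pr => eps eps0.
rewrite add0r.
pose near1 := partial (partial g i) j @^-1` ball (partial (partial g i) j x) (eps / 2).
pose near2 := partial (partial g j) i @^-1` ball (partial (partial g j) i x) (eps / 2).
have n1 : nbhs x near1.
  by apply: ((Ug x Ux).2 j i); apply: nbhsx_ballx; exact: divr_gt0.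
have n2 : nbhs x near2.
  by apply: ((Ug x Ux).2 i j); apply: nbhsx_ballx; exact: divr_gt0.
have Un : nbhs x U by exact: open_nbhs_nbhs.
have /nbhs_ballP[e /= e0 He] : nbhs x (near1 `&` near2 `&` U).
  by apply: filterI => //; exact: filterI.
(* The square of side [e / 4] at [x] stays in the ball of radius [e]. *)
have h0 : 0 < e / 4 by rewrite divr_gt0.
have he : e / 4 + e / 4 < e by lra.
have xeU : ball x e `<=` U by move=> y /He[].
have Ugij a b y : U y -> partial_ex g a y /\ partial_ex (partial g a) b y.
  by move=> Uy; have [[Hy1 Hy2] _] := Ug y Uy; split => //; exact: nbhs_singleton (Hy1 a).
have [y1 xy1 E1] := second_difference e0 xeU (Ugij i j) h0 he.
have [y2 xy2 E2] := second_difference e0 xeU (Ugij j i) h0 he.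
have E : partial (partial g i) j y1 = partial (partial g j) i y2.
  apply: (@mulfI _ (e / 4 * (e / 4))); first by rewrite mulf_neq0// gt_eqF.
  have swap (a b c d : R) : a - b - (c - d) = a - c - (b - d) by ring.
  apply: (eq_trans (esym E1)); apply: (eq_trans _ E2).
  by rewrite (addrAC x (_ *: basis_vec j)) swap.
have [[b1 _] _] : (near1 `&` near2 `&` U) y1.
  by apply: He; rewrite -ball_normE /= distrC; exact: le_lt_trans he.
have [[_ b2] _] : (near1 `&` near2 `&` U) y2.
  by apply: He; rewrite -ball_normE /= distrC; exact: le_lt_trans he.
move: b1 b2; rewrite /near1 /near2 -ball_normE /= => b1 b2.
exact (dist_le_halves E b1 b2).
Qed.

End along_lines.

(** * Geometry of the lens *)

Section lens.
Context {R : realType} {n : nat}.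
Implicit Types (tau s : R) (x : 'rV[R]_n).

Definition lens tau : set ('rV[R]_n * 'rV[R]_n) := Zset tau%:E 0.

Lemma lensE tau z : lens tau z <->
  [/\ enorm z.1 <= enorm (z.1 - z.2), enorm z.2 <= enorm (z.1 - z.2)
    & enorm (z.1 - z.2) <= tau].
Proof.
rewrite /lens /Zset /= !sub0r !enormN ge_max lee_fin.
by split=> [[/andP[]]|[-> -> ->]].
Qed.

Lemma lens_enorm1 tau z : lens tau z -> enorm z.1 <= tau.
Proof. by move=> /lensE[z1 _]; exact: le_trans. Qed.

Lemma lens_enorm2 tau z : lens tau z -> enorm z.2 <= tau.
Proof. by move=> /lensE[_ z2]; exact: le_trans. Qed.

Lemma lens_le s tau : s <= tau -> lens s `<=` lens tau.
Proof.
move=> st z /lensE[z1 z2 zs]; apply/lensE; split=> //; exact: le_trans zs st.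
Qed.

Lemma lens_opp tau :
  (fun z => (0 + (-1) ^+ true *: z.1, 0 + (-1) ^+ true *: z.2)) @^-1` lens tau = lens tau.
Proof.
apply/seteqP; split=> z; rewrite /preimage/= => /lensE/= zl; apply/lensE => /=; move: zl;
  by rewrite !expr1 !scaleN1r !add0r !enormN -opprD enormN.
Qed.

Lemma lens_swap tau : (fun z => (z.2, z.1)) @^-1` lens tau = lens tau.
Proof.
apply/seteqP; split=> z; rewrite /preimage/= => /lensE/= [z1 z2 zt]; apply/lensE => /=;
  by rewrite -opprB enormN; split.
Qed.

Lemma Zset_translate tau x :
  (fun z => (x + (-1) ^+ false *: z.1, x + (-1) ^+ false *: z.2)) @^-1` Zset tau%:E x = lens tau.
Proof.
have E1 (u : 'rV[R]_n) : x - (x + u) = 0 - u by rewrite opprD addrA subrr.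
have E2 (u v : 'rV[R]_n) : x + u - (x + v) = u - v.
  by rewrite opprD addrACA subrr add0r.
by apply/seteqP; split=> z; rewrite /preimage/lens/Zset/= !expr0 !scale1r E2 !E1.
Qed.

Lemma measurable_lens tau : measurable (lens tau).
Proof.
have m1 : measurable_fun setT (fun z : 'rV[R]_n * 'rV[R]_n => enorm z.1).
  exact: (measurableT_comp measurable_enorm measurable_fst).
have m2 : measurable_fun setT (fun z : 'rV[R]_n * 'rV[R]_n => enorm z.2).
  exact: (measurableT_comp measurable_enorm measurable_snd).
have m12 : measurable_fun setT (fun z : 'rV[R]_n * 'rV[R]_n => enorm (z.1 - z.2)).
  apply: (measurableT_comp measurable_enorm); apply: measurable_addr_rV => //.
  rewrite (_ : (fun _ => _) = (fun z : 'rV[R]_n * 'rV[R]_n => -1 *: z.2)).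
    exact: measurable_scale_rV.
  by apply/funext => z; rewrite scaleN1r.
rewrite (_ : lens tau =
   [set z | enorm z.1 <= enorm (z.1 - z.2)] `&` [set z | enorm z.2 <= enorm (z.1 - z.2)]
   `&` [set z | enorm (z.1 - z.2) <= tau]).
  apply: measurableI; first apply: measurableI.
  - by rewrite -[X in measurable X]setTI; exact: measurable_fun_le.
  - by rewrite -[X in measurable X]setTI; exact: measurable_fun_le.
  - by rewrite -[X in measurable X]setTI; exact: measurable_fun_le.
by apply/seteqP; split=> z; [move=> /lensE[]|move=> [[? ?] ?]; apply/lensE].
Qed.

Lemma measurable_Zset tau x : measurable (Zset tau%:E x).
Proof.
have [mT _] := measure_preserving_product (measure_preserving_affine (- x) false)
                                      (measure_preserving_affine (- x) false).
rewrite (_ : Zset tau%:E x =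
  (fun z => (- x + (-1) ^+ false *: z.1, - x + (-1) ^+ false *: z.2)) @^-1` lens tau).
  by rewrite -[X in measurable X]setTI; apply: mT => //; exact: measurable_lens.
have E1 (u : 'rV[R]_n) : 0 - (- x + u) = x - u by rewrite sub0r opprD opprK.
have E2 (u v : 'rV[R]_n) : - x + u - (- x + v) = u - v.
  by rewrite opprD addrACA subrr add0r.
by apply/seteqP; split=> z; rewrite /preimage/lens/Zset/= !expr0 !scale1r E2 !E1.
Qed.

Lemma lens_measure_fin tau : ((lebesgue_rV n \x lebesgue_rV n) (lens tau) < +oo)%E.
Proof.
pose I : set R := `[- tau, tau]%classic.
pose B := [set x : 'rV[R]_n | forall i, I (x ord0 i)].
have mI : measurable I by exact: measurable_itv.
have mB : measurable B by exact: (@measurable_box _ _ (fun=> I)).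
have Bfin : (lebesgue_rV n B < +oo)%E.
  have := @lebesgue_rV_box R n (fun=> I) (fun=> mI).
  move=> /(eq_ind_r (fun y => (y < +oo)%E)); apply.
  rewrite ltey_eq prode_fin_num// => i _.
  by rewrite /= lebesgue_measure_itv/=; case: ifP.
apply: (@le_lt_trans _ _ ((lebesgue_rV n \x lebesgue_rV n) (B `*` B))%E).
  apply: le_measure; rewrite ?inE.
  - exact: measurable_lens.
  - exact: measurableX.
  move=> z zl; split=> i; rewrite /I/= in_itv/= -ler_norml.
    exact: le_trans (coord_le_enorm _ _) (lens_enorm1 zl).
  exact: le_trans (coord_le_enorm _ _) (lens_enorm2 zl).
by rewrite product_measure1E// lte_mul_pinfty// ge0_fin_numE.
Qed.

Lemma lebesgue_rV_ball_gt0 x (e : R) : 0 < e ->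
  measurable (ball x e) /\ (0 < lebesgue_rV n (ball x e))%E.
Proof.
move=> e0.
pose A i : set R := `](x ord0 i - e), (x ord0 i + e)[%classic.
have mA i : measurable (A i) by exact: measurable_itv.
have -> : ball x e = [set y : 'rV[R]_n | forall i, A i (y ord0 i)].
  apply/seteqP; split=> y.
    move=> [_ xy] i; have := xy ord0 i; rewrite /A/= in_itv/= /ball/= ltr_norml.
    by move=> /andP[? ?]; apply/andP; split; lra.
  move=> yA; split=> // i j; rewrite ord1; have := yA j.
  rewrite /A/= in_itv/= /ball/= ltr_norml.
  by move=> /andP[? ?]; apply/andP; split; lra.
split; first exact: measurable_box.
have := @lebesgue_rV_box R n A mA.
move=> /(eq_ind_r (fun y => (0 < y)%E)); apply.
rewrite (eq_bigr (fun=> (e + e)%:E)); last first.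
  move=> i _; rewrite /A /= lebesgue_measure_itv/= lte_fin ifT; last by lra.
  by rewrite -EFinB; congr (_%:E); ring.
rewrite prodEFin lte_fin; apply: prodr_gt0 => i _; exact: addr_gt0.
Qed.

(** For a basis vector [e], the pair (s / 4 e, - s / 4 e) satisfies the three
    inequalities defining the lens strictly, hence is an interior point. *)
Lemma lens_measure_gt0 s : (0 < n)%N -> 0 < s ->
  (0 < (lebesgue_rV n \x lebesgue_rV n) (lens s))%E.
Proof.
move=> n0 s0.
pose w : 'rV[R]_n := (s / 4) *: basis_vec (Ordinal n0).
have wE : enorm w = s / 4.
  rewrite enormZ ger0_norm; last by rewrite divr_ge0// ltW.
  rewrite /enorm (bigD1 (Ordinal n0))//= big1 ?addr0; last first.
    by move=> i ii0; rewrite !mxE eqxx (negbTE ii0)/= expr0n.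
  by rewrite !mxE !eqxx expr1n sqrtr1 mulr1.
have wwE : enorm (w - - w) = s / 2.
  rewrite opprK -mulr2n -scaler_nat enormZ wE ger0_norm//; lra.
pose T := ('rV[R]_n * 'rV[R]_n)%type.
have c1 : continuous (fun z : T => enorm z.1).
  by move=> z; apply: continuous_comp; [exact: cvg_fst|exact: enorm_continuous].
have c2 : continuous (fun z : T => enorm z.2).
  by move=> z; apply: continuous_comp; [exact: cvg_snd|exact: enorm_continuous].
have c12 : continuous (fun z : T => enorm (z.1 - z.2)).
  move=> z; apply: (@continuous_comp _ _ _ (fun z : T => z.1 - z.2) (@enorm R n)).
    by apply: (@continuousB _ _ _ (@fst _ _) (@snd _ _) z); [exact: cvg_fst|exact: cvg_snd].
  exact: enorm_continuous.
have pos (h : T -> R) : continuous h -> 0 < h (w, - w) -> nbhs (w, - w) [set z | 0 < h z].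
  move=> ch hw; apply: (ch (w, - w) [set r | 0 < r]); apply: open_nbhs_nbhs; split => //.
have near : nbhs (w, - w) (lens s).
  have n1 : nbhs (w, - w) [set z | 0 < enorm (z.1 - z.2) - enorm z.1].
    apply: pos; first by move=> z; exact: (continuousB (c12 z) (c1 z)).
    by rewrite /= wwE wE; lra.
  have n2 : nbhs (w, - w) [set z | 0 < enorm (z.1 - z.2) - enorm z.2].
    apply: pos; first by move=> z; exact: (continuousB (c12 z) (c2 z)).
    by rewrite /= enormN wwE wE; lra.
  have n3 : nbhs (w, - w) [set z | 0 < s - enorm (z.1 - z.2)].
    apply: pos; last by rewrite /= wwE; lra.
    by move=> z; exact: (continuousB (@cst_continuous _ _ s z) (c12 z)).
  apply: filterS (filterI (filterI n1 n2) n3) => z /= [[]].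
  by rewrite !subr_gt0 => ? ? ?; apply/lensE; split; exact: ltW.
have [[A B] /= [/nbhs_ballP[e1 /= e10 A1] /nbhs_ballP[e2 /= e20 B2]] AB] := near.
have [mA A0] := lebesgue_rV_ball_gt0 w e10.
have [mB B0] := lebesgue_rV_ball_gt0 (- w) e20.
apply: (@lt_le_trans _ _ ((lebesgue_rV n \x lebesgue_rV n) (ball w e1 `*` ball (- w)%R e2))%E).
  by rewrite product_measure1E//; exact: mule_gt0.
apply: le_measure; rewrite ?inE.
- exact: measurableX.
- exact: measurable_lens.
by move=> z [/A1 zA /B2 zB]; exact: AB.
Qed.

End lens.

(** * Integrals over the lens and their derivatives *)

Section lens_integral.
Context {R : realType} {n : nat}.
Implicit Types (tau : R) (a b f : 'rV[R]_n -> R) (m x z : 'rV[R]_n).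

Local Notation mu := (@lebesgue_rV R n \x @lebesgue_rV R n)%E.

Definition lens_int tau a b z : R :=
  \int[mu]_(w in lens tau) (a (z + w.1) * b (z + w.2)).

(** Local boundedness at each point of [K] spreads to all small translates of
    [K] at once by compactness; bound and translation are treated as one
    parameter going to its limit. *)
Lemma near_bounded_translates (U K : set 'rV[R]_n) a : open U -> compact K ->
  K `<=` U -> (forall x, U x -> {for x, continuous a}) ->
  exists2 M : R, 0 <= M & nbhs (0 : 'rV[R]_n)
    [set h | forall x, K x -> U (x + h) /\ `|a (x + h)| <= M].
Proof.
move=> oU cK KU ca.
pose P (i : 'rV[R]_n * R) x := U (x + i.1) /\ `|a (x + i.1)| <= i.2.
have := (compact_near_coveringP K).1 cK _
  (filter_prod (nbhs (0 : 'rV[R]_n)) (pinfty_nbhs R)) P _.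
case=> [x Kx|[A B] /= [A0 [M [Mr MB]]] AB].
  have Ux := KU x Kx.
  have nU : nbhs x (U `&` [set y | `|a y| <= `|a x| + 1]).
    apply: filterI; first exact: open_nbhs_nbhs.
    apply: filterS (_ : nbhs x (a @^-1` ball (a x) 1)).
      move=> y; rewrite /preimage -ball_normE /= => yx.
      rewrite -[a y](subrK (a x)) addrC.
      by apply: le_trans (ler_normD _ _) _; rewrite lerD2l distrC; exact: ltW.
    by apply: (ca x Ux); exact: nbhsx_ballx.
  have [e /= e0 xe] := (nbhs_ballP _ _).1 nU.
  exists (ball x (e / 2), (ball 0 (e / 2) `*` [set M : R | `|a x| + 1 <= M])) => /=.
    split; first by apply: nbhsx_ballx; exact: divr_gt0.
    exists (ball 0 (e / 2), [set M : R | `|a x| + 1 <= M]) => //=; split.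
      by apply: nbhsx_ballx; exact: divr_gt0.
    exists (`|a x| + 1); split; first exact: num_real.
    by move=> M /ltW.
  move=> [y [h M]] /= [xy [h0 aM]].
  have [] := xe (y + h).
    move: xy h0; rewrite -!ball_normE /= sub0r normrN => xy h0.
    rewrite opprD addrA; apply: le_lt_trans (ler_normB _ _) _.
    by rewrite [ltRHS]splitr; exact: ltrD.
  by move=> Uy /= ay; split=> //; exact: le_trans aM.
exists (Num.max 0 (M + 1)); first by rewrite le_max lexx.
apply: filterS A0 => h Ah x Kx.
have BM : B (Num.max 0 (M + 1)) by apply: MB; rewrite lt_max ltrDl ltr01 orbT.
exact: (AB (h, Num.max 0 (M + 1))).
Qed.

(** The domination needed to integrate [a] over the lens translated to [z]; since
    both points of a lens pair are in the ball, only one point matters. *)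
Definition lens_bounded (U : set 'rV[R]_n) tau a (M : R) z :=
  forall u, enorm u <= tau -> U (z + u) /\ `|a (z + u)| <= M.

Lemma lens_integrable (U : set 'rV[R]_n) tau a b z (M N : R) : open U ->
  (forall x, U x -> {for x, continuous a}) ->
  (forall x, U x -> {for x, continuous b}) ->
  lens_bounded U tau a M z -> lens_bounded U tau b N z ->
  mu.-integrable (lens tau)
    (EFin \o (fun w => a (z + w.1) * b (z + w.2))).
Proof.
move=> oU ca cb aM bN.
have mU : measurable U by exact: open_measurable_rV.
have mz1 : measurable_fun setT (fun w : 'rV[R]_n * 'rV[R]_n => z + w.1).
  exact: measurable_addr_rV.
have mz2 : measurable_fun setT (fun w : 'rV[R]_n * 'rV[R]_n => z + w.2).
  exact: measurable_addr_rV.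
apply: measurable_bounded_integrable.
- exact: measurable_lens.
- exact: lens_measure_fin.
- apply: measurable_funM.
    apply: (measurable_comp mU _ (measurable_fun_continuous_on oU ca)).
      by move=> _ [w /lens_enorm1 /aM[Uz _] <-].
    exact: measurable_funTS.
  apply: (measurable_comp mU _ (measurable_fun_continuous_on oU cb)).
    by move=> _ [w /lens_enorm2 /bN[Uz _] <-].
  exact: measurable_funTS.
exists (M * N); split; first exact: num_real.
move=> r /ltW MNr w lw /=; apply: le_trans MNr; rewrite normrM.
apply: ler_pM => //; first exact: (aM _ (lens_enorm1 lw)).2.
exact: (bN _ (lens_enorm2 lw)).2.
Qed.

Lemma near_lens_bounded (U : set 'rV[R]_n) tau a m : open U ->
  closed_eball m tau `<=` U -> (forall x, U x -> {for x, continuous a}) ->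
  exists2 M : R, 0 <= M & nbhs m (lens_bounded U tau a M).
Proof.
move=> oU mU ca.
have [M M0 nM] := near_bounded_translates oU (@compact_closed_eball _ _ m tau) mU ca.
exists M => //; have /nbhs_ballP[e /= e0 He] := nM.
apply/nbhs_ballP; exists e => // z mz u ut.
have -> : z + u = (m + u) + (z - m) by rewrite addrAC [m + (z - m)]addrC subrK.
apply: He; last by rewrite /closed_eball /= [m + u]addrC addrK.
by move: mz; rewrite -!ball_normE /= sub0r normrN distrC.
Qed.

(** Differentiation under the integral sign along the line through [z] in
    direction [basis_vec i], with the constant [M * M + M * M] dominating the
    derivative of the product; the lens has finite measure. *)
Lemma is_derive_lens_int (U : set 'rV[R]_n) tau a b i z (e M : R) : open U ->
  0 < e -> 0 <= M ->
  (forall x, U x -> [/\ partial_ex a i x, {for x, continuous a}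
                     & {for x, continuous (partial a i)}]) ->
  (forall x, U x -> [/\ partial_ex b i x, {for x, continuous b}
                     & {for x, continuous (partial b i)}]) ->
  (forall y, ball z e y ->
     [/\ lens_bounded U tau a M y, lens_bounded U tau (partial a i) M y,
         lens_bounded U tau b M y & lens_bounded U tau (partial b i) M y]) ->
  is_derive z (basis_vec i) (lens_int tau a b)
    (lens_int tau (partial a i) b z + lens_int tau a (partial b i) z).
Proof.
move=> oU e0 M0 Ca Cb bnd.
have cta x : U x -> {for x, continuous a} by move=> /Ca[].
have ctb x : U x -> {for x, continuous b} by move=> /Cb[].
have ctda x : U x -> {for x, continuous (partial a i)} by move=> /Ca[].
have ctdb x : U x -> {for x, continuous (partial b i)} by move=> /Cb[].
pose v : 'rV[R]_n := basis_vec i.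
pose F t (w : 'rV[R]_n * 'rV[R]_n) := a (z + t *: v + w.1) * b (z + t *: v + w.2).
pose dF t (w : 'rV[R]_n * 'rV[R]_n) :=
  partial a i (z + t *: v + w.1) * b (z + t *: v + w.2)
  + a (z + t *: v + w.1) * partial b i (z + t *: v + w.2).
have tz (t : R) : `](- e), e[%classic t -> ball z e (z + t *: v).
  rewrite /= in_itv/= -ltr_norml => te.
  rewrite -ball_normE /= opprD addrA subrr sub0r normrN normrZ.
  by apply: le_lt_trans te; rewrite ler_piMr//; exact: mx_norm_basis_vec.
have Fder (t : R) w : `](- e), e[%classic t -> lens tau w ->
    is_derive t (1 : R) (F ^~ w) (dF t w).
  move=> /tz/bnd[aM _ bM _] lw.
  have [Ua _] := aM _ (lens_enorm1 lw); have [Ub _] := bM _ (lens_enorm2 lw).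
  have Da : is_derive t (1 : R) (fun s => a (z + s *: v + w.1))
      (partial a i (z + t *: v + w.1)).
    rewrite (_ : (fun s => _) = (fun s => a (z + w.1 + s *: v))); last first.
      by apply/funext => s; rewrite addrAC.
    have Ua' : U (z + w.1 + t *: v) by rewrite addrAC.
    rewrite [z + _ + _]addrAC; apply/is_derive_line; apply: derivableP.
    by have [] := Ca _ Ua'.
  have Db : is_derive t (1 : R) (fun s => b (z + s *: v + w.2))
      (partial b i (z + t *: v + w.2)).
    rewrite (_ : (fun s => _) = (fun s => b (z + w.2 + s *: v))); last first.
      by apply/funext => s; rewrite addrAC.
    have Ub' : U (z + w.2 + t *: v) by rewrite addrAC.
    rewrite [z + _ + _]addrAC; apply/is_derive_line; apply: derivableP.
    by have [] := Cb _ Ub'.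
  have -> : dF t w = a (z + t *: v + w.1) *: partial b i (z + t *: v + w.2)
      + b (z + t *: v + w.2) *: partial a i (z + t *: v + w.1).
    by rewrite /dF addrC [X in _ + X]mulrC.
  exact: (is_deriveM Da Db).
  
have Fint (t : R) : `](- e), e[%classic t -> mu.-integrable (lens tau) (EFin \o F t).
  by move=> /tz/bnd[aM _ bM _]; exact: (lens_integrable oU cta ctb aM bM).
have I0 : `](- e), e[%classic (0 : R) by rewrite /= in_itv/= oppr_lt0 e0.
have Fder1 t w : `](- e), e[%classic t -> lens tau w -> derivable (F ^~ w) t 1.
  by move=> te lw; have [] := Fder t w te lw.
have FG (t : R) w : `](- e), e[%classic t -> lens tau w ->
    `|partial1of2 F t w| <= M * M + M * M.
  move=> te lw; rewrite partial1of2E.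
  rewrite (@derive_val _ _ _ _ _ _ _ (Fder t w te lw)).
  have [aM daM bM dbM] := bnd _ (tz _ te).
  apply: le_trans (ler_normD _ _) _; rewrite !normrM; apply: lerD; apply: ler_pM => //.
  - exact: (daM _ (lens_enorm1 lw)).2.
  - exact: (bM _ (lens_enorm2 lw)).2.
  - exact: (aM _ (lens_enorm1 lw)).2.
  - exact: (dbM _ (lens_enorm2 lw)).2.
have Gint : mu.-integrable (lens tau) (EFin \o (fun=> M * M + M * M)).
  apply: measurable_bounded_integrable => //.
  - exact: measurable_lens.
  - exact: lens_measure_fin.
  - exact: bounded_cst.
have G0 (w : 'rV[R]_n * 'rV[R]_n) : 0 <= M * M + M * M by rewrite addr_ge0// mulr_ge0.
have D1 := @derivable_under_integral R _ _ mu F _ (measurable_lens tau) 0 (- e) e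
  I0 Fint Fder1 _ G0 Gint FG.
have D2 := @differentiation_under_integral R _ _ mu F _ (measurable_lens tau) 0 (- e) e
  I0 Fint Fder1 _ G0 Gint FG.
have z0 : z + 0 *: v = z by rewrite scale0r addr0.
rewrite -z0; apply/is_derive_line; split; first exact: D1.
rewrite -derive1E [LHS]D2.
rewrite (@eq_Rintegral _ _ _ mu (lens tau) (dF 0)); last first.
  move=> w; rewrite inE => lw; have := partial1of2E F 0 w.
  by rewrite (@derive_val _ _ _ _ _ _ _ (Fder 0 w I0 lw)).
have [aM daM bM dbM] := bnd _ (tz _ I0).
rewrite /dF RintegralD//.
- exact: measurable_lens.
- exact: (lens_integrable oU ctda ctb daM bM).
- exact: (lens_integrable oU cta ctdb aM dbM).
Qed.

End lens_integral.

(** * Positivity and symmetries of lens integrals *)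

Section positivity.
Context {R : realType} d (T : measurableType d).
Variable mu : {measure set T -> \bar R}.

Lemma Rintegral_gt0 (D : set T) (g : T -> R) : measurable D ->
  (0 < mu D)%E -> mu.-integrable D (EFin \o g) -> (forall x, D x -> 0 < g x) ->
  0 < \int[mu]_(x in D) g x.
Proof.
move=> mD D0 intg g0; rewrite lt_neqAle.
rewrite Rintegral_ge0 ?andbT; last by move=> x /g0/ltW.
apply/eqP => I0.
have mg : measurable_fun D (EFin \o g) by case/integrableP: intg.
have : (\int[mu]_(x in D) `|(EFin \o g) x| = 0)%E.
  rewrite -[0%E]/(0%:E) I0 /Rintegral fineK; last exact: integrable_fin_num.
  apply: eq_integral => x; rewrite inE => /g0 gx /=.
  by rewrite gtr0_norm.
move=> /(ae_eq_integral_abs _ mD mg) [N [mN N0 DN]].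
suff : (mu D <= mu N)%E by rewrite N0 leNgt D0.
apply: le_measure; rewrite ?inE//.
move=> x Dx; apply: DN => /= /(_ Dx) [] gx0.
by have := g0 x Dx; rewrite gx0 ltxx.
Qed.

Lemma Rintegral_bigsum (D : set T) n (g : 'I_n -> T -> R) : measurable D ->
  (forall i, mu.-integrable D (EFin \o g i)) ->
  mu.-integrable D (EFin \o (fun x => \sum_i g i x)) /\
  \int[mu]_(x in D) (\sum_i g i x) = \sum_i \int[mu]_(x in D) g i x.
Proof.
move=> mD ig.
have E : EFin \o (fun x => \sum_i g i x) = (fun x => \sum_i (EFin \o g i) x)%E.
  by apply/funext => x /=; rewrite sumEFin.
split; first by rewrite E; exact: integrable_sum.
rewrite /Rintegral -[X in integral _ _ X]/(EFin \o (fun x => \sum_i g i x)) E.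
rewrite integral_sum// -sum_fine//.
by move=> i _; apply: integrable_fin_num.
Qed.

End positivity.

Section lens_integral_symmetries.
Context {R : realType} {n : nat}.
Implicit Types (tau : R) (a b f : 'rV[R]_n -> R) (m x z : 'rV[R]_n).

Local Notation mu := (@lebesgue_rV R n \x @lebesgue_rV R n)%E.

(** Passing to the density of the product measure and then translating by [x]. *)
Lemma LLD_lens_int (P : probability 'rV[R]_n R) f tau x : is_density P f ->
  LLD P tau%:E x = lens_int tau f f x.
Proof.
move=> hf; rewrite /LLD /lens_int /Rintegral; congr fine.
have mZ := measurable_Zset tau x.
rewrite integral_indic// setIT; apply: (eq_trans (product_density hf mZ)).
have [f0 mf _] := hf.
have pres := measure_preserving_product (measure_preserving_affine x false)
                                        (measure_preserving_affine x false).
rewrite (ge0_integral_measure_preserving pres)//.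
- by rewrite Zset_translate; apply: eq_integral => z _ /=; rewrite !scale1r.
- apply/measurable_EFinP; apply: measurable_funTS; apply: measurable_funM.
    exact: (measurableT_comp mf measurable_fst).
  exact: (measurableT_comp mf measurable_snd).
by move=> z _; rewrite lee_fin mulr_ge0.
Qed.

Lemma lens_int_swap tau a b z :
  mu.-integrable (lens tau) (EFin \o (fun w => a (z + w.1) * b (z + w.2))) ->
  lens_int tau a b z = lens_int tau b a z.
Proof.
move=> /integrableP[/measurable_EFinP mab _].
rewrite /lens_int.
rewrite (Rintegral_measure_preserving (measure_preserving_swap _) (measurable_lens tau) mab).
by rewrite lens_swap; apply: eq_Rintegral => w _ /=; rewrite mulrC.
Qed.

(** An odd function times an even one integrates to zero over the lens, which
    is invariant under a reflection through the origin. *)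
Lemma lens_int_odd_even tau a b z :
  mu.-integrable (lens tau) (EFin \o (fun w => a (z + w.1) * b (z + w.2))) ->
  (forall u, enorm u <= tau -> a (z - u) = - a (z + u)) ->
  (forall u, enorm u <= tau -> b (z - u) = b (z + u)) ->
  lens_int tau a b z = 0.
Proof.
move=> intab oa eb.
suff : lens_int tau a b z = - lens_int tau a b z.
  by move/eqP; rewrite -subr_eq0 opprK -mulr2n mulrn_eq0 => /eqP.
rewrite -[RHS]mulN1r -RintegralZl//; last exact: measurable_lens.
have /integrableP[/measurable_EFinP mab _] := intab.
have pres := measure_preserving_product (measure_preserving_affine (0 : 'rV[R]_n) true)
                                        (measure_preserving_affine (0 : 'rV[R]_n) true).
rewrite /lens_int (Rintegral_measure_preserving pres (measurable_lens tau) mab).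
rewrite lens_opp; apply: eq_Rintegral => w; rewrite inE => lw /=.
rewrite expr1 !scaleN1r !add0r oa ?eb ?mulNr ?mul1r//.
  exact: lens_enorm2 lw.
exact: lens_enorm1 lw.
Qed.

End lens_integral_symmetries.

Section central_symmetry.
Context {R : realType} {n : nat}.
Implicit Types (tau : R) (f : 'rV[R]_n -> R) (m u v : 'rV[R]_n).

Lemma is_derive_opp_dir f x v (D : R) :
  is_derive x v f D -> is_derive x (- v) f (- D).
Proof.
move=> fD.
have D1 : is_derive (0 : R) (1 : R) (fun s => f (x + s *: v)) D.
  by apply/is_derive_line; rewrite scale0r addr0.
have D2 := is_derive1_comp (f := fun s => f (x + s *: v)) (g := -%R) (x := 0).
have /= := D2 D (-1) _ _.
rewrite oppr0 mulrN1 => /(_ D1 (is_deriveNid _ _)) => D3.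
have x0 : x + (0 : R) *: - v = x by rewrite scale0r addr0.
rewrite -x0; apply/is_derive_line; move: D3; congr (is_derive _ _ _ _).
by apply/funext => s /=; rewrite scaleNr scalerN.
Qed.

(** Inside the ball this is the chain rule; on the sphere it follows by
    continuity of the partial derivative along the radius. *)
Lemma partial_centrally_symmetric (U : set 'rV[R]_n) f tau m i : open U ->
  0 < tau -> closed_eball m tau `<=` U ->
  (forall x, U x -> partial_ex f i x /\ {for x, continuous (partial f i)}) ->
  (forall u, enorm u <= tau -> f (m + u) = f (m - u)) ->
  forall u, enorm u <= tau -> partial f i (m - u) = - partial f i (m + u).
Proof.
move=> oU tau0 mU Uf sym.
have inU u : enorm u <= tau -> U (m + u).
  by move=> ut; apply: mU; rewrite /closed_eball /= [m + u]addrC addrK.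
have inner u : enorm u < tau -> partial f i (m - u) = - partial f i (m + u).
  move=> ut.
  have ut' : enorm (- u) <= tau by rewrite enormN ltW.
  have /Uf[Df1 _] := inU _ (ltW ut); have /Uf[Df2 _] := inU _ ut'.
  have D1 := is_derive_opp_dir (derivableP Df2).
  have D2 := derivableP Df1.
  suff D3 : is_derive (m + u) (basis_vec i) f (- 'D_(basis_vec i) f (m - u)).
    by rewrite {2}/partial (@derive_val _ _ _ _ _ _ _ D3) opprK.
  apply: (@near_eq_is_derive _ _ _ (fun y => f (m + m - y))).
    pose B := (fun y : 'rV[R]_n => enorm (y - m)) @^-1` [set r | r < tau].
    have nB : nbhs (m + u) B.
      have cB : {for m + u, continuous (fun y : 'rV[R]_n => enorm (y - m))}.
        apply: continuous_comp; last exact: enorm_continuous.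
        by apply: (@continuousB _ _ _ id (cst m)); [by move=> ?|exact: (@cst_continuous _ _ m)].
      apply: (cB [set r | r < tau]); apply: open_nbhs_nbhs; split => //=.
      by rewrite [m + u]addrC addrK.
    apply: filterS nB => y; rewrite /B /preimage /= => /ltW/sym.
    by rewrite [m + (y - m)]addrC subrK opprB addrA => ->.
  have z0 : m + u + (0 : R) *: basis_vec i = m + u by rewrite scale0r addr0.
  rewrite -z0; apply/is_derive_line.
  rewrite (_ : (fun s => _) = (fun s => f (m - u + s *: - basis_vec i))); last first.
    apply/funext => s; congr f; rewrite scalerN !opprD addrA addrA addrK.
    by [].
  by apply/is_derive_line; rewrite scale0r addr0.
move=> u; rewrite le_eqVlt => /orP[/eqP ut|]; last exact: inner.
pose h (t : R) := partial f i (m - t *: u) + partial f i (m + t *: u).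
suff h1 : h 1 = 0.
  by move: h1; rewrite /h scale1r => /eqP; rewrite addr_eq0 => /eqP.
apply/eqP/negPn/negP => h10.
have ct (w : 'rV[R]_n) : enorm w <= tau ->
    {for 1, continuous (fun t : R => partial f i (m + t *: w))}.
  move=> wt.
  apply: (@continuous_comp _ _ _ (fun t : R => m + t *: w) (partial f i)).
    by apply: (@continuousD _ _ _ (cst m) (fun t : R => t *: w));
      [exact: (@cst_continuous _ _ m)|exact: scalel_continuous].
  by rewrite /= scale1r; have [] := Uf _ (inU _ wt).
have ch : {for 1, continuous h}.
  apply: (@continuousD _ _ _ (fun t : R => partial f i (m - t *: u))); last first.
    by apply: ct; rewrite ut.
  rewrite (_ : (fun t => _) = (fun t : R => partial f i (m + t *: - u))); last first.
    by apply/funext => t; rewrite scalerN.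
  by apply: ct; rewrite enormN ut.
have : nbhs (1 : R) (h @^-1` [set r | r != 0]).
  by apply: ch; apply: open_nbhs_nbhs; split => //; exact: open_neq.
move=> /nbhs_ballP[e /= e0 he].
(* A parameter less than 1 and in the ball of radius [e] around 1, so that
   [t *: u] is inside the ball, where [h] vanishes. *)
pose t := 1 - Num.min e 1 / 2.
have me0 : 0 < Num.min e 1 by rewrite lt_min e0 ltr01.
have me1 : Num.min e 1 <= 1 by rewrite ge_min lexx orbT.
have mee : Num.min e 1 <= e by rewrite ge_min lexx.
have : ball (1 : R) e t.
  by rewrite -ball_normE /= /t opprB addrC subrK gtr0_norm ?divr_gt0//; lra.
move=> /he; rewrite /preimage /= /h inner ?addNr ?eqxx//.
rewrite enormZ ut ger0_norm; last by rewrite /t; lra.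
by rewrite gtr_pMl// /t; lra.
Qed.

End central_symmetry.

(** * The lens integral of the density near the centre of symmetry *)

Section lens_int_hessian.
Context {R : realType} {n : nat}.
Implicit Types (tau : R) (a b f : 'rV[R]_n -> R) (m x z : 'rV[R]_n).

Local Notation mu := (@lebesgue_rV R n \x @lebesgue_rV R n)%E.

Lemma lens_bounded_le (U : set 'rV[R]_n) tau a (M N : R) z : M <= N ->
  lens_bounded U tau a M z -> lens_bounded U tau a N z.
Proof. by move=> MN aM u /aM[Uz az]; split=> //; exact: le_trans MN. Qed.

Lemma near_lens_bounded_family (I : finType) (U : set 'rV[R]_n) tau
    (a : I -> 'rV[R]_n -> R) m : open U -> closed_eball m tau `<=` U ->
  (forall k x, U x -> {for x, continuous (a k)}) ->
  exists2 M : R, 0 <= M & nbhs m [set z | forall k, lens_bounded U tau (a k) M z].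
Proof.
move=> oU mU ca.
have /choice[M HM] : forall k, exists M : R, 0 <= M /\ nbhs m (lens_bounded U tau (a k) M).
  by move=> k; have [M M0 nM] := near_lens_bounded oU mU (ca k); exists M.
exists (\sum_k M k); first by apply: sumr_ge0 => k _; exact: (HM k).1.
apply: (@filter_forall _ _ (fun k => lens_bounded U tau (a k) (\sum_k M k)) (nbhs m) _ _) => k.
apply: filterS (HM k).2 => z; apply: lens_bounded_le.
rewrite (bigD1 k)//= lerDl; apply: sumr_ge0 => j _; exact: (HM j).1.
Qed.

(** Continuity of [f] and of its first partial derivatives is included, because
    it is what the integrals need; existence and continuity of the second ones
    imply it. *)
Definition C2_on (U : set 'rV[R]_n) f :=
  [/\ forall i x, U x -> partial_ex f i x,
      forall x, U x -> {for x, continuous f},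
      forall i j x, U x -> partial_ex (partial f i) j x,
      forall i x, U x -> {for x, continuous (partial f i)} &
      forall i j x, U x -> {for x, continuous (partial (partial f i) j)}].

Lemma continuous_partials2_C2_on (U : set 'rV[R]_n) f : open U ->
  (forall x, U x -> hessian_ex f x /\
     forall i j, {for x, continuous (partial (partial f j) i)}) ->
  C2_on U f.
Proof.
move=> oU Uf.
have p1 i x : U x -> partial_ex f i x.
  by move=> /Uf[[fx _] _]; exact: nbhs_singleton (fx i).
have p2 i j x : U x -> partial_ex (partial f i) j x by move=> /Uf[[_ +] _]; exact.
have c2 i j x : U x -> {for x, continuous (partial (partial f i) j)}.
  by move=> /Uf[_ +]; exact.
have c1 i x : U x -> {for x, continuous (partial f i)}.
  by apply: continuous_partials_continuous => // y Uy j; split; [exact: p2|exact: c2].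
split => // x; apply: continuous_partials_continuous => // y Uy j.
by split; [exact: p1|exact: c1].
Qed.

Section at_centre.
Variables (U : set 'rV[R]_n) (tau : R) (f : 'rV[R]_n -> R) (m : 'rV[R]_n).
Hypotheses (oU : open U) (mU : closed_eball m tau `<=` U) (Uf : C2_on U f).

Definition lens_jet_bounded (M : R) z :=
  [/\ lens_bounded U tau f M z,
      forall i, lens_bounded U tau (partial f i) M z &
      forall i j, lens_bounded U tau (partial (partial f i) j) M z].

Lemma near_lens_jet_bounded : exists2 M : R, 0 <= M & nbhs m (lens_jet_bounded M).
Proof.
have [_ c0 _ c1 c2] := Uf.
have [M0 M00 n0] := near_lens_bounded oU mU c0.
have [M1 M10 n1] := near_lens_bounded_family oU mU c1.
have [M2 M20 n2] := near_lens_bounded_family (I := ('I_n * 'I_n)%type)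
  (a := fun k => partial (partial f k.1) k.2) oU mU (fun k => c2 k.1 k.2).
exists (M0 + M1 + M2); first by rewrite !addr_ge0.
apply: filterS (filterI (filterI n0 n1) n2) => z [[b0 b1] b2]; split.
- by apply: lens_bounded_le b0; rewrite -addrA lerDl addr_ge0.
- by move=> i; apply: lens_bounded_le (b1 i); rewrite addrAC lerDr addr_ge0.
- by move=> i j; apply: lens_bounded_le (b2 (i, j)); rewrite lerDr addr_ge0.
Qed.

(** The partial derivatives of [lens_int tau f f] as given by the product rule,
    before any use of symmetry. *)
Definition lens_grad i z : R :=
  lens_int tau (partial f i) f z + lens_int tau f (partial f i) z.

Definition lens_hess i j z : R :=
  lens_int tau (partial (partial f i) j) f z + lens_int tau (partial f i) (partial f j) z
  + (lens_int tau (partial f j) (partial f i) z + lens_int tau f (partial (partial f i) j) z).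

Lemma near_is_derive_lens_int : \forall z \near m,
  (forall i, is_derive z (basis_vec i) (lens_int tau f f) (lens_grad i z)) /\
  (forall i j, is_derive z (basis_vec j) (lens_grad i) (lens_hess i j z)).
Proof.
have [p1 c0 p2 c1 c2] := Uf.
have [M M0 /nbhs_ballP[e /= e0 He]] := near_lens_jet_bounded.
apply/nbhs_ballP; exists (e / 2) => [|z mz]; first exact: divr_gt0.
have e20 : 0 < e / 2 by exact: divr_gt0.
have ze y : ball z (e / 2) y -> lens_jet_bounded M y.
  by move=> zy; apply: He; rewrite [e]splitr; exact: ball_triangle mz zy.
split=> [i|i j].
  apply: (is_derive_lens_int oU e20 M0).
  - by move=> x Ux; split; [exact: p1|exact: c0|exact: c1].
  - by move=> x Ux; split; [exact: p1|exact: c0|exact: c1].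
  by move=> y /ze[b0 b1 _]; split.
apply: is_deriveD; apply: (is_derive_lens_int oU e20 M0).
- by move=> x Ux; split; [exact: p2|exact: c1|exact: c2].
- by move=> x Ux; split; [exact: p1|exact: c0|exact: c1].
- by move=> y /ze[b0 b1 b2]; split.
- by move=> x Ux; split; [exact: p1|exact: c0|exact: c1].
- by move=> x Ux; split; [exact: p2|exact: c1|exact: c2].
by move=> y /ze[b0 b1 b2]; split.
Qed.

Lemma lens_jet_integrable : 
  [/\ mu.-integrable (lens tau) (EFin \o (fun w => f (m + w.1) * f (m + w.2))),
   forall i, mu.-integrable (lens tau) (EFin \o (fun w => partial f i (m + w.1) * f (m + w.2))),
   forall i j, mu.-integrable (lens tau)
     (EFin \o (fun w => partial f i (m + w.1) * partial f j (m + w.2))) &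
   forall i j, mu.-integrable (lens tau)
     (EFin \o (fun w => partial (partial f i) j (m + w.1) * f (m + w.2)))].
Proof.
have [p1 c0 p2 c1 c2] := Uf.
have [M M0 /nbhs_singleton[b0 b1 b2]] := near_lens_jet_bounded.
split=> [|i|i j|i j].
- exact: (lens_integrable oU c0 c0 b0 b0).
- exact: (lens_integrable oU (c1 i) c0 (b1 i) b0).
- exact: (lens_integrable oU (c1 i) (c1 j) (b1 i) (b1 j)).
- exact: (lens_integrable oU (c2 i j) c0 (b2 i j) b0).
Qed.

Lemma lens_GmxE i j w : Gmx f (m + w.1) (m + w.2) i j =
  partial (partial f j) i (m + w.1) * f (m + w.2)
  + partial f i (m + w.1) * partial f j (m + w.2).
Proof. by rewrite !mxE big_ord1 !mxE mulrC. Qed.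

Lemma Gmx_integrable i j : mu.-integrable (lens tau)
  (EFin \o (fun w => Gmx f (m + w.1) (m + w.2) i j)).
Proof.
have [_ _ ip ih] := lens_jet_integrable.
have := integrableD (measurable_lens tau) (ih j i) (ip i j).
by apply: eq_integrable; [exact: measurable_lens|move=> w _ /=; rewrite lens_GmxE EFinD].
Qed.

(** The two halves of the product rule contribute equally because the lens is
    invariant under exchanging its two points. *)
Lemma lens_hessE i j : lens_hess j i m =
  2 * \int[mu]_(w in lens tau) Gmx f (m + w.1) (m + w.2) i j.
Proof.
have [_ _ ip ih] := lens_jet_integrable.
have -> : \int[mu]_(w in lens tau) Gmx f (m + w.1) (m + w.2) i j =
    lens_int tau (partial (partial f j) i) f m + lens_int tau (partial f i) (partial f j) m.
  rewrite -(RintegralD (measurable_lens tau) (ih j i) (ip i j)).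
  by apply: eq_Rintegral => w _; exact: lens_GmxE.
have E (a b c d : R) : a = d -> b = c -> a + b + (c + d) = 2 * (a + c).
  by move=> <- <-; rewrite [X in _ + X]addrC mulr_natl mulr2n.
exact (E _ _ _ _ (lens_int_swap (ih j i)) (lens_int_swap (ip j i))).
Qed.

Lemma lens_hessC i j : (forall x, U x -> hessian_ex f x /\
     forall i j, {for x, continuous (partial (partial f j) i)}) ->
  lens_hess i j m = lens_hess j i m.
Proof.
move=> Uf2; have [_ _ ip ih] := lens_jet_integrable.
have E (a b c d a' d' : R) : a = a' -> a = d -> a' = d' -> b = c ->
    a + b + (c + d) = a' + c + (b + d').
  by move=> <- <- <- <-.
have pC : lens_int tau (partial (partial f i) j) f m =
          lens_int tau (partial (partial f j) i) f m.
  apply: eq_Rintegral => w; rewrite inE => lw.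
  have /(partialC i j oU Uf2) -> // : U (m + w.1).
  by apply: mU; rewrite /closed_eball /= [m + _]addrC addrK; exact: lens_enorm1 lw.
exact (E _ _ _ _ _ _ pC (lens_int_swap (ih i j)) (lens_int_swap (ih j i))
  (lens_int_swap (ip i j))).
Qed.

Lemma lens_grad_eq0 i : 0 < tau -> 
  (forall u, enorm u <= tau -> f (m + u) = f (m - u)) -> lens_grad i m = 0.
Proof.
move=> tau0 sym; have [p1 _ _ c1 _] := Uf; have [_ ig _ _] := lens_jet_integrable.
rewrite /lens_grad -(lens_int_swap (ig i)) (lens_int_odd_even (ig i)) ?addr0// => u ut.
  apply: (partial_centrally_symmetric oU tau0 mU) ut => // x Ux.
  by split; [exact: p1|exact: c1].
by rewrite [RHS]sym.
Qed.

(** The lens of a small size is part of the given one and has positive measure,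
    and both factors of the integrand are positive on it. *)
Lemma near_lens_int_gt0 : (0 < n)%N -> 0 < tau -> (forall x, 0 <= f x) -> 0 < f m ->
  \forall z \near m, 0 < lens_int tau f f z.
Proof.
move=> n0 tau0 f0 fm.
have [_ c0 _ _ _] := Uf.
have [M M0 nb] := near_lens_bounded oU mU c0.
have Um : U m by apply: mU; rewrite /closed_eball /= subrr enorm0 ltW.
have nf : nbhs m (f @^-1` [set r | 0 < r]).
  by apply: (c0 m Um); apply: open_nbhs_nbhs; split.
have /nbhs_ballP[e /= e0 He] := nf.
have nball : nbhs m (ball m (e / 2)) by apply: nbhsx_ballx; exact: divr_gt0.
apply: filterS (filterI nb nball) => z [bz mz].
(* For [z] within [e / 2] of [m], the points [z + u] with [u] in the lens of
   size [s < e / 2] are within [e] of [m]. *)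
pose s := Num.min tau (e / 4).
have s0 : 0 < s by rewrite lt_min tau0 divr_gt0.
have st : s <= tau by rewrite ge_min lexx.
have se : s < e / 2.
  apply: (@le_lt_trans _ _ (e / 4)); first by rewrite ge_min lexx orbT.
  by rewrite ltr_pM2l// ltf_pV2 ?posrE// ltr_nat.
have pos u : enorm u <= s -> 0 < f (z + u).
  move=> us; apply: He; rewrite [e]splitr; apply: ball_triangle mz _.
  rewrite -ball_normE /= opprD addrA subrr sub0r normrN.
  apply: le_lt_trans se; apply: le_trans us.
  by apply: mx_norm_le => [|i]; [exact: enorm_ge0|exact: coord_le_enorm].
have intz := lens_integrable oU c0 c0 bz bz.
have ints : mu.-integrable (lens s) (EFin \o (fun w => f (z + w.1) * f (z + w.2))).
  apply: integrableS intz; [exact: measurable_lens|exact: measurable_lens|exact: lens_le].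
have := Rintegral_gt0 (measurable_lens s) (lens_measure_gt0 n0 s0) ints.
move=> /(_ _)/lt_le_trans; apply.
  by move=> w lw; rewrite mulr_gt0// pos//; [exact: lens_enorm1 lw|exact: lens_enorm2 lw].
rewrite /lens_int /Rintegral; apply: fine_le.
- by apply: integrable_fin_num ints; exact: measurable_lens.
- by apply: integrable_fin_num intz; exact: measurable_lens.
apply: ge0_subset_integral.
- exact: measurable_lens.
- exact: measurable_lens.
- by case/integrableP: intz.
- by move=> w _; rewrite lee_fin mulr_ge0.
exact: lens_le.
Qed.

End at_centre.

End lens_int_hessian.

(** * Critical points of a square root, and eigenvalues of symmetric matrices *)

Section square_root.
Context {R : realType} {n : nat}.
Implicit Types (g : 'rV[R]_n -> R) (m x v : 'rV[R]_n).

Lemma is_derive_sqrt_comp g x v (D : R) : 0 < g x -> is_derive x v g D ->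
  is_derive x v (fun y => Num.sqrt (g y)) ((2 * Num.sqrt (g x))^-1 * D).
Proof.
move=> gx gD.
have x0 : x + (0 : R) *: v = x by rewrite scale0r addr0.
have D1 : is_derive (0 : R) (1 : R) (fun s => g (x + s *: v)) D.
  by apply/is_derive_line; rewrite x0.
have gx0 : 0 < g (x + (0 : R) *: v) by rewrite x0.
have D2 := is_derive1_comp (is_derive1_sqrt gx0) D1.
rewrite x0 in D2.
by rewrite -{1}x0; apply/is_derive_line.
Qed.

(** At a critical point the Hessian of [c * sqrt g] is a positive multiple of
    that of [g]: the term with the square of the gradient vanishes. *)
Lemma sqrt_hessian g m (c : R) (g1 : 'I_n -> 'rV[R]_n -> R) (g2 : 'I_n -> 'I_n -> R) :
  (\forall z \near m, 0 < g z /\ forall i, is_derive z (basis_vec i) g (g1 i z)) ->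
  (forall i j, is_derive m (basis_vec j) (g1 i) (g2 i j)) ->
  (forall i, g1 i m = 0) ->
  let h y := c * Num.sqrt (g y) in
  [/\ hessian_ex h m, grad h m = 0 &
      hessian h m = (c / (2 * Num.sqrt (g m))) *: \matrix_(i, j) g2 j i].
Proof.
move=> near_g dg1 g10 h.
pose q z := (2 * Num.sqrt (g z))^-1.
pose h1 i z := c * (q z * g1 i z).
have near_h : \forall z \near m, forall i, is_derive z (basis_vec i) h (h1 i z).
  apply: filterS near_g => z [gz dg] i.
  exact: (is_deriveZ (c : R) (is_derive_sqrt_comp gz (dg i))).
have near_h1 i : \forall z \near m, h1 i z = partial h i z.
  by apply: filterS near_h => z dh; rewrite /partial (@derive_val _ _ _ _ _ _ _ (dh i)).
have [gm dgm] := nbhs_singleton near_g.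
have sgm : 0 < 2 * Num.sqrt (g m) by rewrite mulr_gt0// sqrtr_gt0.
have dq j : derivable q m (basis_vec j).
  apply: derivableV; first by rewrite gt_eqF.
  have := is_deriveZ (2 : R) (is_derive_sqrt_comp gm (dgm j)).
  by case.
have dh1 i j : is_derive m (basis_vec j) (partial h i) (c * (q m * g2 i j)).
  apply: near_eq_is_derive (near_h1 i) _.
  have := is_deriveZ (c : R) (is_deriveM (derivableP (dq j)) (dg1 i j)).
  by rewrite g10 scale0r addr0.
split.
- split; last by move=> i j; case: (dh1 j i).
  by move=> j; apply: filterS near_h => z /(_ j)[].
- apply/colP => i; rewrite !mxE -(nbhs_singleton (near_h1 i)) /h1 g10.
  by rewrite !mulr0.
apply/matrixP => i j; rewrite !mxE {1}/partial (@derive_val _ _ _ _ _ _ _ (dh1 j i)).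
by rewrite mulrA.
Qed.

End square_root.

Section symmetric_eigenvalues.
Context {R : realType} {n : nat}.
Implicit Types A : 'M[R]_n.

Let dot (x y : 'rV[R]_n) := (x *m y^T) ord0 ord0.

Lemma dot_ge0 x : 0 <= dot x x.
Proof. by rewrite /dot mxE sumr_ge0// => i _; rewrite mxE -expr2 sqr_ge0. Qed.

Lemma dot_gt0 x : x != 0 -> 0 < dot x x.
Proof.
move=> x0; rewrite lt_neqAle dot_ge0 andbT eq_sym; apply: contra x0.
rewrite /dot mxE psumr_eq0; last by move=> i _; rewrite mxE -expr2 sqr_ge0.
move=> /allP x0; apply/eqP/rowP => i; rewrite mxE.
have /implyP/(_ isT) := x0 i (mem_index_enum _).
by rewrite mxE -expr2 sqrf_eq0 => /eqP.
Qed.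

(** The real and imaginary parts of an eigenvector of a real symmetric matrix
    span an invariant subspace; comparing the two mixed products shows that the
    eigenvalue is real. *)
Lemma symmetric_eigenvalue A (z : R[i]) : A^T = A -> complex_eigenvalue A z ->
  exists2 y : 'cV[R]_n, y != 0 &
    exists2 r : R, 0 < r & (y^T *m A *m y) ord0 ord0 = complex.Re z * r /\ complex.Im z = 0.
Proof.
move=> AT /eigenvalueP[v vA v0].
case: z vA => s t vA /=.
pose a : 'rV[R]_n := map_mx (@complex.Re R) v.
pose b : 'rV[R]_n := map_mx (@complex.Im R) v.
have ReD : {morph @complex.Re R : x y / x + y} by case=> ? ? [? ?].
have ImD : {morph @complex.Im R : x y / x + y} by case=> ? ? [? ?].
have aA : a *m A = s *: a - t *: b.
  apply/rowP => j; have /rowP/(_ j) := vA; rewrite !mxE => /(congr1 (@complex.Re R)).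
  rewrite (big_morph _ ReD (erefl : complex.Re (0 : R[i]) = 0)).
  case: (v ord0 j) => x y /= <-; apply: eq_bigr => k _; rewrite !mxE.
  by case: (v ord0 k) => x' y' /=; rewrite mulr0 subr0.
have bA : b *m A = s *: b + t *: a.
  apply/rowP => j; have /rowP/(_ j) := vA; rewrite !mxE => /(congr1 (@complex.Im R)).
  rewrite (big_morph _ ImD (erefl : complex.Im (0 : R[i]) = 0)).
  case: (v ord0 j) => x y /= <-; apply: eq_bigr => k _; rewrite !mxE.
  by case: (v ord0 k) => x' y' /=; rewrite mulr0 add0r.
have abv : (a != 0) || (b != 0).
  apply: contraNT v0; rewrite negb_or !negbK => /andP[/eqP a0 /eqP b0].
  apply/eqP/rowP => j; have /rowP/(_ j) := a0; have /rowP/(_ j) := b0.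
  by rewrite !mxE; case: (v ord0 j) => x y /= -> ->.
have dotE (x y : 'rV[R]_n) : (x *m A *m y^T) ord0 ord0 = (y *m A *m x^T) ord0 ord0.
  rewrite -[y *m A *m x^T]trmxK [RHS]mxE.
  by rewrite !trmx_mul !trmxK AT mulmxA.
have dotA (x y : 'rV[R]_n) (r r' : R) (w : 'rV[R]_n) : x *m A = r *: x + r' *: w ->
    (x *m A *m y^T) ord0 ord0 = r * dot x y + r' * dot w y.
  by move=> ->; rewrite mulmxDl -!scalemxAl mxE [X in X + _]mxE [X in _ + X]mxE.
have ab : dot a b = dot b a.
  by rewrite /dot !mxE; apply: eq_bigr => i _; rewrite !mxE mulrC.
have aA' : a *m A = s *: a + (- t) *: b by rewrite scaleNr.
have t0 : t = 0.
  have := dotE a b; rewrite (dotA _ _ _ _ _ aA') (dotA _ _ _ _ _ bA) ab.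
  move=> /addrI/eqP; rewrite mulNr -subr_eq0 -opprD oppr_eq0 -mulrDr mulf_eq0.
  case/orP => [/eqP//|]; rewrite gt_eqF//.
  by case/orP: abv => /dot_gt0 ?; [rewrite ltr_wpDl// dot_ge0|rewrite ltr_wpDr// dot_ge0].
case/orP: abv => [a0|b0].
  exists a^T; first by rewrite trmx_eq0.
  exists (dot a a); first exact: dot_gt0.
  by rewrite trmxK (dotA a a _ _ _ aA') t0 oppr0 mul0r addr0.
exists b^T; first by rewrite trmx_eq0.
exists (dot b b); first exact: dot_gt0.
by rewrite trmxK (dotA b b _ _ _ bA) t0 mul0r addr0.
Qed.

Lemma neg_definite_eigenvalues A : A^T = A -> neg_definite A ->
  only_neg_eigenvalues A.
Proof.
move=> AT An z /(symmetric_eigenvalue AT)[y /An yA [r r0 [yE z0]]].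
by rewrite ltcE /= z0 eqxx /=; move: yA; rewrite yE pmulr_llt0.
Qed.

Lemma pos_definite_eigenvalues A : A^T = A -> pos_definite A ->
  only_pos_eigenvalues A.
Proof.
move=> AT Ap z /(symmetric_eigenvalue AT)[y /Ap yA [r r0 [yE z0]]].
by rewrite ltcE /= z0 eqxx /=; move: yA; rewrite yE pmulr_lgt0.
Qed.

End symmetric_eigenvalues.

(** * The main theorem *)

Section hessian_of_depth.
Context {R : realType} {n : nat}.
Variables (U : set 'rV[R]_n) (tau : R) (f : 'rV[R]_n -> R) (m : 'rV[R]_n).
Hypotheses (n0 : (0 < n)%N) (tau0 : 0 < tau).
Hypotheses (oU : open U) (mU : closed_eball m tau `<=` U) (Uf : C2_on U f).

Local Notation mu := (@lebesgue_rV R n \x @lebesgue_rV R n)%E.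

Lemma quadratic_formE (A : 'M[R]_n) (y : 'cV[R]_n) :
  (y^T *m A *m y) ord0 ord0 = \sum_j \sum_i (y j ord0 * y i ord0) * A i j.
Proof.
rewrite mxE; apply: eq_bigr => j _; rewrite mxE big_distrl /=.
by apply: eq_bigr => i _; rewrite !mxE mulrC mulrA.
Qed.

(** The factor [s] is a sign: it lets the negative and the positive definite case
    share one proof. *)
Lemma lens_hess_form_sign (s : R) (y : 'cV[R]_n) :
  (forall x1 x2, closed_eball m tau x1 -> closed_eball m tau x2 ->
     0 < s * (y^T *m Gmx f x1 x2 *m y) ord0 ord0) ->
  0 < s * (y^T *m \matrix_(i, j) lens_hess tau f j i m *m y) ord0 ord0.
Proof.
move=> sG.
have mL := measurable_lens (n := n) tau.
have intG := Gmx_integrable oU mU Uf.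
pose q w := (y^T *m Gmx f (m + w.1) (m + w.2) *m y) ord0 ord0.
have intGc i j : mu.-integrable (lens tau)
    (EFin \o (fun w => (y j ord0 * y i ord0) * Gmx f (m + w.1) (m + w.2) i j)).
  exact: (integrableZl mL (y j ord0 * y i ord0) (intG i j)).
have intGr j := Rintegral_bigsum mL (fun i => intGc i j).
have intq := Rintegral_bigsum mL (fun j => (intGr j).1).
have qE : q = fun w => \sum_j \sum_i (y j ord0 * y i ord0) * Gmx f (m + w.1) (m + w.2) i j.
  by apply/funext => w; exact: quadratic_formE.
have -> : (y^T *m \matrix_(i, j) lens_hess tau f j i m *m y) ord0 ord0 =
    2 * \int[mu]_(w in lens tau) q w.
  rewrite qE intq.2 quadratic_formE mulr_sumr; apply: eq_bigr => j _.
  rewrite (intGr j).2 mulr_sumr; apply: eq_bigr => i _.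
  rewrite RintegralZl//.
  by rewrite mxE (lens_hessE oU mU Uf) mulrCA.
have iq : mu.-integrable (lens tau) (EFin \o q) by rewrite qE; exact: intq.1.
rewrite mulrCA pmulr_rgt0// -RintegralZl//.
apply: Rintegral_gt0 => //.
- exact: lens_measure_gt0.
- exact: (integrableZl mL s iq).
move=> w lw; apply: sG; rewrite /closed_eball /= [m + _]addrC addrK.
  exact: lens_enorm1 lw.
exact: lens_enorm2 lw.
Qed.

End hessian_of_depth.

Lemma Lambda1_gt0 (R : realType) n : (0 < n)%N -> 0 < @Lambda1 R n.
Proof.
move=> n0; apply: fine_gt0.
by rewrite (lens_measure_gt0 n0 ltr01) lens_measure_fin.
Qed.

Lemma f_tau_lens_int (R : realType) n (P : probability 'rV[R]_n R) f tau :
  is_density P f -> f_tau P tau =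
  (fun x => 1 / (tau ^+ n * Num.sqrt (@Lambda1 R n)) * Num.sqrt (lens_int tau f f x)).
Proof. by move=> hf; apply/funext => x; rewrite /f_tau (LLD_lens_int _ _ hf). Qed.

(** Everything that the mode and the antimode case have in common. *)
Lemma f_tau_critical (R : realType) n (P : probability 'rV[R]_n R)
    (f : 'rV[R]_n -> R) (tau : R) (m : 'rV[R]_n) :
  (0 < n)%N -> is_density P f -> 0 < tau -> centrally_symmetric f tau m ->
  continuous_partials2_on f (closed_eball m tau) ->
  [/\ pos_set (f_tau P tau) m, hessian_ex (f_tau P tau) m, grad (f_tau P tau) m = 0 &
    exists H : 'M[R]_n, [/\ H^T = H, hessian (f_tau P tau) m = H &
      forall (s : R) (y : 'cV[R]_n),
      (forall x1 x2, closed_eball m tau x1 -> closed_eball m tau x2 ->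
        0 < s * (y^T *m Gmx f x1 x2 *m y) ord0 ord0) ->
      0 < s * (y^T *m H *m y) ord0 ord0]].
Proof.
move=> n0 hf tau0 [fm sym] [U [oU mU Uf2]].
have Uf := continuous_partials2_C2_on oU Uf2.
have [f0 _ _] := hf.
rewrite (f_tau_lens_int tau hf).
set c := 1 / _.
have c0 : 0 < c.
  by rewrite divr_gt0// mulr_gt0 ?exprn_gt0// sqrtr_gt0; exact: Lambda1_gt0.
have nD := near_is_derive_lens_int oU mU Uf.
have nP := near_lens_int_gt0 oU mU Uf n0 tau0 f0 fm.
have Fm := nbhs_singleton nP.
have near_g : \forall z \near m, 0 < lens_int tau f f z /\
    forall i, is_derive z (basis_vec i) (lens_int tau f f) (lens_grad tau f i z).
  by apply: filterS (filterI nD nP) => z [[D _] F0]; split.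
have [hex hgrad hhess] := sqrt_hessian c near_g (nbhs_singleton nD).2
  (fun i => lens_grad_eq0 oU mU Uf i tau0 sym).
split => //; first by rewrite /pos_set /= mulr_gt0// sqrtr_gt0.
have k0 : 0 < c / (2 * Num.sqrt (lens_int tau f f m)).
  by rewrite divr_gt0// mulr_gt0// sqrtr_gt0.
exists ((c / (2 * Num.sqrt (lens_int tau f f m))) *: \matrix_(i, j) lens_hess tau f j i m).
split; [|exact hhess|].
  rewrite linearZ /=; congr (_ *: _); apply/matrixP => i j.
  rewrite [LHS]mxE [LHS]mxE [RHS]mxE.
  exact (lens_hessC oU mU Uf i j Uf2).
move=> s y sG; rewrite -scalemxAr -scalemxAl mxE mulrCA pmulr_rgt0//.
exact: lens_hess_form_sign oU mU Uf _ _ sG.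
Qed.

Unset Implicit Arguments.

Theorem theorem3p4 (R : realType) (p : nat) (hp : (1 <= p)%N)
    (P : probability 'rV[R]_p R) (f : 'rV[R]_p -> R) (hf : is_density P f)
    (tau : R) (htau : 0 < tau) (m : 'rV[R]_p)
    (hsym : centrally_symmetric f tau m)
    (hC2 : continuous_partials2_on f (closed_eball m tau)) :
  (mode f m ->
   (forall x1 x2, closed_eball m tau x1 -> closed_eball m tau x2 ->
      neg_definite (Gmx f x1 x2)) ->
   mode (f_tau P tau) m) /\
  (antimode f m ->
   (forall x1 x2, closed_eball m tau x1 -> closed_eball m tau x2 ->
      pos_definite (Gmx f x1 x2)) ->
   antimode (f_tau P tau) m).
Proof.
have [fpos fex fgrad [H [HT fH HG]]] := f_tau_critical hp hf htau hsym hC2.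
split=> _ Gdef; split=> //; rewrite fH.
- apply: neg_definite_eigenvalues => // y y0.
  rewrite -oppr_gt0 -mulN1r; apply: HG => x1 x2 mx1 mx2.
  by rewrite mulN1r oppr_gt0; exact: Gdef.
- apply: pos_definite_eigenvalues => // y y0.
  rewrite -[ltRHS]mul1r; apply: HG => x1 x2 mx1 mx2.
  by rewrite mul1r; exact: Gdef.
Qed.
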